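(* Let $K$ be a field and let $H$ be a Hopf algebra over $K$ with an $ad$-invariant integral and such that $H$ is formally smooth as an algebra in the category of $K$-vector spaces. Let $\mathcal{M}$ be either $\mathfrak{M}^{H}$ or ${}^{H}\mathfrak{M}^{H}$. Let $E$ be an algebra in $\mathcal{M}$ and let $\pi:E\to H$ be an algebra homomorphism in $\mathcal{M}$ which is surjective and has nilpotent kernel. Then $\pi$ has a section which is an algebra homomorphism in $\mathcal{M}$.
   Context: Notation: $\Delta(h)=h_1\otimes h_2$ (Sweedler), $\varepsilon$ the counit, $S$ the antipode of $H$. $ad$-invariant integral: $\lambda\in H^{*}$ such that (a) $h_1\lambda(h_2)=1_H\lambda(h)$ for all $h\in H$; (b) $\lambda(h_1xS(h_2))=\varepsilon(h)\lambda(x)$ for all $h,x\in H$; (c) $\lambda(1_H)=1_K$. $\mathfrak{M}^H$ (resp. ${}^H\mathfrak{M}^H$) is the monoidal category of right $H$-comodules (resp. $H$-bicomodules), with $\otimes_K$ carrying codiagonal coaction(s) and unit $K$. $H$ is an algebra in both via $\Delta$. An algebra homomorphism in $\mathcal{M}$ is an algebra homomorphism that is a morphism of $\mathcal{M}$. A $K$-algebra $A$ with multiplication $m:A\otimes_K A\to A$ is formally smooth as an algebra in the category of $K$-vector spaces if the $A$-bimodule $\Omega^1A=\ker m$ is projective relative to those $A$-bimodule morphisms that split as $K$-linear maps (since $K$ is a field, equivalently it is a projective $A$-bimodule). *)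

(* Defs.v *)
From HB Require Import structures.
From mathcomp Require Import all_boot all_order all_algebra.
From mathcomp Require Import boolp.

Set Implicit Arguments.
Unset Strict Implicit.
Unset Printing Implicit Defensive.

Import GRing.Theory.
Local Open Scope ring_scope.
Local Open Scope quotient_scope.

Reserved Notation "v ⊗ w" (at level 40, left associativity).
Reserved Notation "V ⊗[ K ] W"
  (at level 40, left associativity, format "V  ⊗[ K ]  W").

Section Tensor.
Variables (K : fieldType) (V W : lmodType K).
Implicit Types (s t : seq (V * W)) (v : V) (w : W) (a : K).

(* A list [:: (v1, w1); ...; (vn, wn)] stands for the formal sum of the
   vi ⊗ wi.  The relation is the congruence, for concatenation, presenting
   V ⊗ W; opposites and scalars are obtained by acting on the first factor. *)
Inductive tens_eqv : seq (V * W) -> seq (V * W) -> Prop :=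
| tens_eqv_refl s : tens_eqv s s
| tens_eqv_sym s t : tens_eqv s t -> tens_eqv t s
| tens_eqv_trans s t u : tens_eqv s t -> tens_eqv t u -> tens_eqv s u
| tens_eqv_cat s s' t t' :
    tens_eqv s s' -> tens_eqv t t' -> tens_eqv (s ++ t) (s' ++ t')
| tens_eqv_catC s t : tens_eqv (s ++ t) (t ++ s)
| tens_eqv_0 w : tens_eqv [:: (0, w)] [::]
| tens_eqv_Dl v v' w : tens_eqv [:: (v + v', w)] [:: (v, w); (v', w)]
| tens_eqv_Dr v w w' : tens_eqv [:: (v, w + w')] [:: (v, w); (v, w')]
| tens_eqv_Z a v w : tens_eqv [:: (a *: v, w)] [:: (v, a *: w)].

Definition tens_rel : rel (seq (V * W)) := fun s t => `[< tens_eqv s t >].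

Lemma tens_rel_refl : reflexive tens_rel.
Proof. by move=> s; apply/asboolP; constructor. Qed.

Lemma tens_rel_sym : symmetric tens_rel.
Proof. by move=> s t; apply/asboolP/asboolP => ?; apply: tens_eqv_sym. Qed.

Lemma tens_rel_trans : transitive tens_rel.
Proof.
move=> t s u /asboolP st /asboolP tu; apply/asboolP.
exact: tens_eqv_trans tu.
Qed.

Canonical tens_equiv := EquivRel tens_rel tens_rel_refl tens_rel_sym tens_rel_trans.

Definition tensor : Type := {eq_quot tens_rel}.

HB.instance Definition _ := Choice.on tensor.
HB.instance Definition _ := EqQuotient.on tensor.

Definition tens v w : tensor := \pi_tensor [:: (v, w)].

Lemma eq_tensorP s t : reflect (tens_eqv s t) (\pi_tensor s == \pi_tensor t).
Proof. by rewrite piE; apply: asboolP. Qed.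

Lemma eq_tensor s t : tens_eqv s t -> \pi_tensor s = \pi_tensor t.
Proof. by move=> /eq_tensorP/eqP. Qed.

Lemma repr_tensor s : tens_eqv (repr (\pi_tensor s)) s.
Proof. by apply/eq_tensorP; rewrite reprK. Qed.

Definition tensor_scale_seq a s := [seq (a *: p.1, p.2) | p <- s].

Definition tensor_add (x y : tensor) : tensor := \pi_tensor (repr x ++ repr y).
Definition tensor_scale a (x : tensor) : tensor :=
  \pi_tensor (tensor_scale_seq a (repr x)).

Lemma tensor_scale_eqv a s t :
  tens_eqv s t -> tens_eqv (tensor_scale_seq a s) (tensor_scale_seq a t).
Proof.
elim=> {s t} /=.
- by move=> s; apply: tens_eqv_refl.
- by move=> s t _; apply: tens_eqv_sym.
- by move=> s t u _ + _; apply: tens_eqv_trans.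
- by move=> s s' t t' _ ? _ ?; rewrite /tensor_scale_seq !map_cat; apply: tens_eqv_cat.
- by move=> s t; rewrite /tensor_scale_seq !map_cat; apply: tens_eqv_catC.
- by move=> w; rewrite scaler0; apply: tens_eqv_0.
- by move=> v v' w; rewrite scalerDr; apply: tens_eqv_Dl.
- by move=> v w w'; apply: tens_eqv_Dr.
- by move=> b v w; rewrite scalerA mulrC -scalerA; apply: tens_eqv_Z.
Qed.

Lemma pi_tensor_add s t :
  tensor_add (\pi_tensor s) (\pi_tensor t) = \pi_tensor (s ++ t).
Proof. by apply: eq_tensor; apply: tens_eqv_cat; apply: repr_tensor. Qed.

Lemma pi_tensor_scale a s :
  tensor_scale a (\pi_tensor s) = \pi_tensor (tensor_scale_seq a s).
Proof. by apply: eq_tensor; apply/tensor_scale_eqv/repr_tensor. Qed.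

Lemma tensor_addA : associative tensor_add.
Proof.
move=> x y z; rewrite -[x]reprK -[y]reprK -[z]reprK.
rewrite (pi_tensor_add (repr y)) (pi_tensor_add (repr x) (repr y)).
by rewrite !pi_tensor_add catA.
Qed.

Lemma tensor_addC : commutative tensor_add.
Proof.
move=> x y; rewrite -[x]reprK -[y]reprK !pi_tensor_add.
exact/eq_tensor/tens_eqv_catC.
Qed.

Lemma tensor_add0 : left_id (\pi_tensor [::]) tensor_add.
Proof. by move=> x; rewrite -[x]reprK pi_tensor_add. Qed.

Lemma tensor_scaleDl x : {morph tensor_scale^~ x : a b / a + b >-> tensor_add a b}.
Proof.
move=> a b; rewrite -[x]reprK !pi_tensor_scale pi_tensor_add; apply: eq_tensor.
elim: (repr x) => [|[v w] s IHs] /=; first exact: tens_eqv_refl.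
set sa := tensor_scale_seq a s in IHs *; set sb := tensor_scale_seq b s in IHs *.
rewrite scalerDl.
apply: (tens_eqv_trans (tens_eqv_cat (tens_eqv_Dl _ _ w) IHs)).
have -> : (a *: v, w) :: sa ++ (b *: v, w) :: sb =
    [:: (a *: v, w)] ++ (sa ++ [:: (b *: v, w)]) ++ sb by rewrite -catA.
apply: (@tens_eqv_cat [:: (a *: v, w)] _ (([:: (b *: v, w)] ++ sa) ++ sb)).
  exact: tens_eqv_refl.
apply: tens_eqv_cat; last exact: tens_eqv_refl.
exact: tens_eqv_catC.
Qed.

Lemma tensor_scale0 x : tensor_scale 0 x = \pi_tensor [::].
Proof.
rewrite -[x]reprK pi_tensor_scale; apply: eq_tensor.
elim: (repr x) => [|[v w] s IHs] /=; first exact: tens_eqv_refl.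
rewrite scale0r.
exact: (tens_eqv_cat (tens_eqv_0 w) IHs).
Qed.

Lemma tensor_scale1 : left_id 1 tensor_scale.
Proof.
move=> x; rewrite -[x]reprK pi_tensor_scale /tensor_scale_seq.
by congr (\pi_tensor _); elim: (repr x) => //= -[v w] s ->; rewrite scale1r.
Qed.

Lemma tensor_addN : left_inverse (\pi_tensor [::]) (tensor_scale (-1)) tensor_add.
Proof.
move=> x; rewrite -{2}[x]tensor_scale1 -tensor_scaleDl addNr.
exact: tensor_scale0.
Qed.

HB.instance Definition _ :=
  GRing.isZmodule.Build tensor tensor_addA tensor_addC tensor_add0 tensor_addN.

Lemma tensor_scaleA a b x :
  tensor_scale a (tensor_scale b x) = tensor_scale (a * b) x.
Proof.
rewrite -[x]reprK (pi_tensor_scale b) !pi_tensor_scale /tensor_scale_seq.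
rewrite -map_comp; congr (\pi_tensor _).
by apply: eq_map => p /=; rewrite scalerA.
Qed.

Lemma pi_tensorD s t :
  \pi_tensor s + \pi_tensor t = \pi_tensor (s ++ t) :> tensor.
Proof. exact: pi_tensor_add. Qed.

Lemma tensor_scaleDr : right_distributive tensor_scale +%R.
Proof.
move=> a x y; rewrite -[x]reprK -[y]reprK.
rewrite (pi_tensorD (repr x)) (pi_tensor_scale _ (repr x)).
rewrite (pi_tensor_scale _ (repr y)) pi_tensorD pi_tensor_scale.
by rewrite /tensor_scale_seq map_cat.
Qed.

HB.instance Definition _ := GRing.Zmodule_isLmodule.Build K tensor
  tensor_scaleA tensor_scale1 tensor_scaleDr tensor_scaleDl.

Lemma pi_tensorZ a s :
  a *: (\pi_tensor s : tensor) = \pi_tensor (tensor_scale_seq a s).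
Proof. exact: pi_tensor_scale. Qed.

Lemma tensDl v v' w : tens (v + v') w = tens v w + tens v' w.
Proof. by rewrite [RHS]pi_tensorD; apply/eq_tensor/tens_eqv_Dl. Qed.

Lemma tensDr v w w' : tens v (w + w') = tens v w + tens v w'.
Proof. by rewrite [RHS]pi_tensorD; apply/eq_tensor/tens_eqv_Dr. Qed.

Lemma tensZl a v w : tens (a *: v) w = a *: tens v w.
Proof. by rewrite [RHS]pi_tensorZ. Qed.

Lemma tensZr a v w : tens v (a *: w) = a *: tens v w.
Proof. by rewrite -tensZl; apply/esym/eq_tensor/tens_eqv_Z. Qed.

Lemma tensor_sum (x : tensor) : x = \sum_(p <- repr x) tens p.1 p.2.
Proof.
rewrite -{1}[x]reprK; elim: (repr x) => [|[v w] s IHs].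
  by rewrite big_nil.
by rewrite big_cons -IHs /= [RHS]pi_tensorD.
Qed.

End Tensor.

Arguments tensor {K} (V W)%_type_scope.
Arguments tens {K V W} v w.

Notation "V ⊗[ K ] W" := (@tensor K V W).
Notation "v ⊗ w" := (tens v w) : ring_scope.

(* The linear map V ⊗ W -> U sending v ⊗ w to f v w; it does not depend on
   representatives as soon as f is bilinear. *)
Definition tlift (K : fieldType) (V W U : lmodType K) (f : V -> W -> U)
    (x : V ⊗[K] W) : U :=
  \sum_(p <- repr x) f p.1 p.2.

Section TensorLift.
Variables (K : fieldType) (V W U : lmodType K) (f : V -> W -> U).
Hypothesis f_bilin : bilinear_for *:%R *:%R f.

Let fDl v v' w : f (v + v') w = f v w + f v' w.
Proof. by have := f_bilin.1 w 1 v v'; rewrite /= !scale1r. Qed.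
Let fDr v w w' : f v (w + w') = f v w + f v w'.
Proof. by have := f_bilin.2 v 1 w w'; rewrite /= !scale1r. Qed.
Let f0l w : f 0 w = 0.
Proof. by apply: (addrI (f 0 w)); rewrite -fDl !addr0. Qed.
Let f0r v : f v 0 = 0.
Proof. by apply: (addrI (f v 0)); rewrite -fDr !addr0. Qed.
Let fZl a v w : f (a *: v) w = a *: f v w.
Proof. by have := f_bilin.1 w a v 0; rewrite /= f0l !addr0. Qed.
Let fZr a v w : f v (a *: w) = a *: f v w.
Proof. by have := f_bilin.2 v a w 0; rewrite /= f0r !addr0. Qed.

Lemma tlift_eqv s t : tens_eqv s t ->
  \sum_(p <- s) f p.1 p.2 = \sum_(p <- t) f p.1 p.2.
Proof.
elim=> {s t} //=.
- by move=> s t u _ -> _ ->.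
- by move=> s s' t t' _ IHs _ IHt; rewrite !big_cat /= IHs IHt.
- by move=> s t; rewrite !big_cat /= addrC.
- by move=> w; rewrite big_seq1 big_nil f0l.
- by move=> v v' w; rewrite !big_cons !big_nil !addr0 /= fDl.
- by move=> v w w'; rewrite !big_cons !big_nil !addr0 /= fDr.
- by move=> a v w; rewrite !big_seq1 /= fZl fZr.
Qed.

Lemma tlift_pi s : tlift f (\pi_(V ⊗[K] W) s) = \sum_(p <- s) f p.1 p.2.
Proof. exact/tlift_eqv/repr_tensor. Qed.

Lemma tlift_tens v w : tlift f (v ⊗ w) = f v w.
Proof. by rewrite tlift_pi big_seq1. Qed.

Lemma tlift_is_linear : linear (tlift f).
Proof.
move=> a x y; rewrite -[x]reprK -[y]reprK.
rewrite [a *: _]pi_tensorZ [_ + _]pi_tensorD !tlift_pi big_cat /=.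
congr (_ + _); rewrite big_map scaler_sumr.
by apply: eq_bigr => p _; rewrite fZl.
Qed.

End TensorLift.

Section TensorMaps.
Variable K : fieldType.
Implicit Types U V W : lmodType K.

Definition tmap V V' W W' (f : V -> V') (g : W -> W') :
    V ⊗[K] W -> V' ⊗[K] W' :=
  tlift (fun v w => f v ⊗ g w).

Definition tassoc V1 V2 V3 : (V1 ⊗[K] V2) ⊗[K] V3 -> V1 ⊗[K] (V2 ⊗[K] V3) :=
  tlift (fun x v3 => tlift (fun v1 v2 => v1 ⊗ (v2 ⊗ v3)) x).

(* v1 ⊗ v2 ⊗ v3 ⊗ v4 |-> v1 ⊗ v3 ⊗ v2 ⊗ v4 *)
Definition tinterchange V1 V2 V3 V4 :
    (V1 ⊗[K] V2) ⊗[K] (V3 ⊗[K] V4) -> (V1 ⊗[K] V3) ⊗[K] (V2 ⊗[K] V4) :=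
  tlift (fun x y =>
    tlift (fun v1 v2 => tlift (fun v3 v4 => (v1 ⊗ v3) ⊗ (v2 ⊗ v4)) y) x).

Lemma tensor_ext V W U (f g : V ⊗[K] W -> U) : linear f -> linear g ->
  (forall v w, f (v ⊗ w) = g (v ⊗ w)) -> f =1 g.
Proof.
move=> f_lin g_lin fg x; rewrite [x]tensor_sum.
pose F := GRing.isLinear.Build _ _ _ _ f f_lin.
pose G := GRing.isLinear.Build _ _ _ _ g g_lin.
pose f' : {linear _ -> _} := HB.pack f F; pose g' : {linear _ -> _} := HB.pack g G.
by rewrite -[f]/(f' : _ -> _) -[g]/(g' : _ -> _) !linear_sum; apply: eq_bigr.
Qed.

Lemma tmap_bilinear V V' W W' (f : V -> V') (g : W -> W') :
  linear f -> linear g -> bilinear_for *:%R *:%R (fun v w => f v ⊗ g w).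
Proof.
move=> f_lin g_lin; split=> [w | v] a y z /=.
  by rewrite f_lin tensDl tensZl.
by rewrite g_lin tensDr tensZr.
Qed.

Lemma tmap_tens V V' W W' (f : V -> V') (g : W -> W') v w :
  linear f -> linear g -> tmap f g (v ⊗ w) = f v ⊗ g w.
Proof. by move=> fl gl; apply/(tlift_tens (tmap_bilinear fl gl)). Qed.

Lemma tmap_is_linear V V' W W' (f : V -> V') (g : W -> W') :
  linear f -> linear g -> linear (tmap f g).
Proof. by move=> fl gl; apply/tlift_is_linear/tmap_bilinear. Qed.

Definition mult (A : algType K) : A ⊗[K] A -> A := tlift (fun a b => a * b).

Definition tmul (A B : algType K) (x y : A ⊗[K] B) : A ⊗[K] B :=
  tmap (@mult A) (@mult B) (tinterchange (x ⊗ y)).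

Lemma mult_bilinear (A : algType K) :
  bilinear_for *:%R *:%R (fun a b : A => a * b).
Proof.
split=> [b | a] k x y /=; first by rewrite mulrDl scalerAl.
by rewrite mulrDr scalerAr.
Qed.

Lemma mult_tens (A : algType K) (a b : A) : mult (a ⊗ b) = a * b.
Proof. exact/tlift_tens/mult_bilinear. Qed.

Lemma mult_is_linear (A : algType K) : linear (@mult A).
Proof. exact/tlift_is_linear/mult_bilinear. Qed.

HB.instance Definition _ (A : algType K) :=
  GRing.isLinear.Build _ _ _ _ (@mult A) (@mult_is_linear A).

End TensorMaps.

Arguments mult {K A} x.

(* tlift (fun h1 h2 => E) (comul h) is the Sweedler expression E in h1 ⊗ h2. *)
HB.mixin Record isCoalgebra (K : fieldType) C of GRing.Lmodule K C := {
  comul : {linear C -> C ⊗[K] C};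
  counit : {scalar C};
  comulA : forall c, tassoc (tmap comul id (comul c)) = tmap id comul (comul c);
  comul_counitl : forall c, tlift (fun c1 c2 => counit c1 *: c2) (comul c) = c;
  comul_counitr : forall c, tlift (fun c1 c2 => counit c2 *: c1) (comul c) = c
}.

#[short(type="coalgType")]
HB.structure Definition Coalgebra (K : fieldType) :=
  {C of GRing.Lmodule K C & isCoalgebra K C}.

HB.mixin Record Algebra_isHopf (K : fieldType) H
    of GRing.Algebra K H & Coalgebra K H := {
  comulM : forall x y : H, comul (x * y) = tmul (comul x) (comul y);
  comul1 : comul (1 : H) = 1 ⊗ 1;
  counitM : forall x y : H, counit (x * y) = counit x * counit y;
  counit1 : counit (1 : H) = 1;
  antipode : {linear H -> H};
  antipodel : forall h : H,
    tlift (fun h1 h2 => antipode h1 * h2) (comul h) = counit h *: 1;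
  antipoder : forall h : H,
    tlift (fun h1 h2 => h1 * antipode h2) (comul h) = counit h *: 1
}.

#[short(type="hopfAlgType")]
HB.structure Definition HopfAlgebra (K : fieldType) :=
  {H of GRing.Algebra K H & Coalgebra K H & Algebra_isHopf K H}.

Definition ad_invariant_integral (K : fieldType) (H : hopfAlgType K)
    (lambda : {scalar H}) : Prop :=
  [/\ forall h : H,
        tlift (fun h1 h2 => lambda h2 *: h1) (comul h) = lambda h *: 1,
      forall h x : H,
        tlift (fun h1 h2 => lambda (h1 * x * antipode h2) : K^o) (comul h)
          = counit h * lambda x
    & lambda 1 = 1].

Section Comodules.
Variables (K : fieldType) (H : hopfAlgType K).
Implicit Types U V W : lmodType K.

Definition rcomodule V (r : {linear V -> V ⊗[K] H}) : Prop :=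
  (forall v, tassoc (tmap r id (r v)) = tmap id comul (r v)) /\
  (forall v, tlift (fun v0 h => counit h *: v0) (r v) = v).

Definition lcomodule V (l : {linear V -> H ⊗[K] V}) : Prop :=
  (forall v, tassoc (tmap comul id (l v)) = tmap id l (l v)) /\
  (forall v, tlift (fun h v0 => counit h *: v0) (l v) = v).

Definition bicomodule V (l : {linear V -> H ⊗[K] V})
    (r : {linear V -> V ⊗[K] H}) : Prop :=
  [/\ lcomodule l, rcomodule r
    & forall v, tassoc (tmap l id (r v)) = tmap id r (l v)].

Definition rcolinear V W (rV : V -> V ⊗[K] H) (rW : W -> W ⊗[K] H)
    (f : V -> W) : Prop :=
  forall v, rW (f v) = tmap f id (rV v).

Definition lcolinear V W (lV : V -> H ⊗[K] V) (lW : W -> H ⊗[K] W)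
    (f : V -> W) : Prop :=
  forall v, lW (f v) = tmap id f (lV v).

Definition rcodiag V W (rV : V -> V ⊗[K] H) (rW : W -> W ⊗[K] H)
    (x : V ⊗[K] W) : (V ⊗[K] W) ⊗[K] H :=
  tmap id mult (tinterchange (tmap rV rW x)).

Definition lcodiag V W (lV : V -> H ⊗[K] V) (lW : W -> H ⊗[K] W)
    (x : V ⊗[K] W) : H ⊗[K] (V ⊗[K] W) :=
  tmap mult id (tinterchange (tmap lV lW x)).

Definition rtriv (k : K^o) : K^o ⊗[K] H := k ⊗ 1.

Definition ltriv (k : K^o) : H ⊗[K] K^o := 1 ⊗ k.

(* The forgetful functors to vector spaces being monoidal, an algebra in the
   category of (bi)comodules is a K-algebra whose multiplication E ⊗ E -> E and
   unit K -> E are morphisms of (bi)comodules. *)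
Definition rcomod_algebra (E : algType K) (r : {linear E -> E ⊗[K] H}) : Prop :=
  [/\ rcomodule r,
      rcolinear (rcodiag r r) r mult
    & rcolinear rtriv r (fun k : K^o => k *: 1)].

Definition bicomod_algebra (E : algType K)
    (l : {linear E -> H ⊗[K] E}) (r : {linear E -> E ⊗[K] H}) : Prop :=
  [/\ bicomodule l r,
      lcolinear (lcodiag l l) l mult /\ rcolinear (rcodiag r r) r mult
    & lcolinear ltriv l (fun k : K^o => k *: 1) /\
      rcolinear rtriv r (fun k : K^o => k *: 1)].

End Comodules.

(* The two actions of K agree, being both the scalar multiplication of the
   underlying vector space: this is what the bilinearity of lact and ract says. *)
Record bimodule (K : fieldType) (A : algType K) := Bimodule {
  bimod_sort :> lmodType K;
  lact : A -> bimod_sort -> bimod_sort;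
  ract : bimod_sort -> A -> bimod_sort;
  lact_bilinear : bilinear_for *:%R *:%R lact;
  ract_bilinear : bilinear_for *:%R *:%R ract;
  lact1 : forall x, lact 1 x = x;
  ract1 : forall x, ract x 1 = x;
  lactM : forall a b x, lact (a * b) x = lact a (lact b x);
  ractM : forall a b x, ract x (a * b) = ract (ract x a) b;
  lractA : forall a b x, ract (lact a x) b = lact a (ract x b)
}.

Definition bimod_morph (K : fieldType) (A : algType K) (M N : bimodule A)
    (f : {linear M -> N}) : Prop :=
  (forall a x, f (lact a x) = lact a (f x)) /\
  (forall a x, f (ract x a) = ract (f x) a).

Definition rel_projective (K : fieldType) (A : algType K) (P : bimodule A) :
    Prop :=
  forall (M N : bimodule A) (g : {linear M -> N}),
    bimod_morph g -> (exists s : {linear N -> M}, cancel s g) ->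
  forall f : {linear P -> N}, bimod_morph f ->
  exists2 h : {linear P -> M}, bimod_morph h & forall x, g (h x) = f x.

Section Omega1.
Variables (K : fieldType) (A : algType K).
Implicit Types (a b : A) (x y : A ⊗[K] A).

Definition outer_lact a x : A ⊗[K] A := tmap ( *%R a) id x.
Definition outer_ract x b : A ⊗[K] A := tmap id ( *%R^~ b) x.

Let id_linear : linear (@id A). Proof. by []. Qed.
Let lmul_linear a : linear ( *%R a). Proof. exact: (mult_bilinear A).2. Qed.
Let rmul_linear b : linear ( *%R^~ b). Proof. exact: (mult_bilinear A).1. Qed.

Lemma outer_lact_tens a b c : outer_lact a (b ⊗ c) = (a * b) ⊗ c.
Proof. exact: tmap_tens. Qed.

Lemma outer_ract_tens a b c : outer_ract (a ⊗ b) c = a ⊗ (b * c).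
Proof. exact: (tmap_tens a b id_linear (rmul_linear c)). Qed.

Lemma outer_lact_linear a : linear (outer_lact a).
Proof. exact: tmap_is_linear. Qed.

Lemma outer_ract_linear b : linear (outer_ract^~ b).
Proof. exact: (tmap_is_linear id_linear (rmul_linear b)). Qed.

Lemma outer_lact_bilinear : bilinear_for *:%R *:%R outer_lact.
Proof.
split=> [x | a]; last exact: outer_lact_linear.
move=> k a b /=; move: x; apply: tensor_ext => [|l x y|c d].
- exact: outer_lact_linear.
- rewrite !outer_lact_linear !scalerDr !scalerA [l * k]mulrC.
  by rewrite -!addrA; congr (_ + _); rewrite addrCA.
- by rewrite !outer_lact_tens mulrDl -scalerAl tensDl tensZl.
Qed.

Lemma outer_ract_bilinear : bilinear_for *:%R *:%R outer_ract.
Proof.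
split=> [b | x]; first exact: outer_ract_linear.
move=> k a b /=; move: x; apply: tensor_ext => [|l x y|c d].
- exact: outer_ract_linear.
- rewrite !(outer_ract_linear _ l) !scalerDr !scalerA [l * k]mulrC.
  by rewrite -!addrA; congr (_ + _); rewrite addrCA.
- by rewrite !outer_ract_tens mulrDr -scalerAr tensDr tensZr.
Qed.

Lemma outer_lact1 x : outer_lact 1 x = x.
Proof.
move: x; apply: tensor_ext => [|//|a b]; first exact: outer_lact_linear.
by rewrite outer_lact_tens mul1r.
Qed.

Lemma outer_ract1 x : outer_ract x 1 = x.
Proof.
move: x; apply: tensor_ext => [|//|a b]; first exact: outer_ract_linear.
by rewrite outer_ract_tens mulr1.
Qed.

Lemma outer_lactM a b x : outer_lact (a * b) x = outer_lact a (outer_lact b x).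
Proof.
move: x; apply: tensor_ext => [|k x y|c d]; first exact: outer_lact_linear.
  by rewrite !outer_lact_linear.
by rewrite !outer_lact_tens mulrA.
Qed.

Lemma outer_ractM a b x : outer_ract x (a * b) = outer_ract (outer_ract x a) b.
Proof.
move: x; apply: tensor_ext => [|k x y|c d]; first exact: outer_ract_linear.
  by rewrite !outer_ract_linear.
by rewrite !outer_ract_tens mulrA.
Qed.

Lemma outer_lractA a b x :
  outer_ract (outer_lact a x) b = outer_lact a (outer_ract x b).
Proof.
move: x; apply: tensor_ext => [k x y|k x y|c d].
- by rewrite outer_lact_linear outer_ract_linear.
- by rewrite outer_ract_linear outer_lact_linear.
- by rewrite outer_lact_tens !outer_ract_tens outer_lact_tens.
Qed.

Lemma mult_outer_lact a x : mult (outer_lact a x) = a * mult x.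
Proof.
move: x; apply: tensor_ext => [k x y|k x y|b c].
- by rewrite outer_lact_linear linearP.
- by rewrite linearP mulrDr scalerAr.
- by rewrite outer_lact_tens !mult_tens mulrA.
Qed.

Lemma mult_outer_ract x b : mult (outer_ract x b) = mult x * b.
Proof.
move: x; apply: tensor_ext => [k x y|k x y|a c].
- by rewrite outer_ract_linear linearP.
- by rewrite linearP mulrDl scalerAl.
- by rewrite outer_ract_tens !mult_tens mulrA.
Qed.

Definition in_Omega1 : {pred A ⊗[K] A} := fun x => mult x == 0.

Lemma in_Omega1_submod : submod_closed in_Omega1.
Proof.
split=> [|k x y]; rewrite !unfold_in ?linear0 // => /eqP x0 /eqP y0.
by rewrite linearP /= x0 y0 scaler0 addr0.
Qed.

HB.instance Definition _ :=
  GRing.isSubmodClosed.Build K (A ⊗[K] A : lmodType K) in_Omega1 in_Omega1_submod.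

Record Omega1 := MkOmega1 { Omega1_val : A ⊗[K] A; _ : Omega1_val \in in_Omega1 }.

HB.instance Definition _ := [isSub for Omega1_val].
HB.instance Definition _ := [Choice of Omega1 by <:].
HB.instance Definition _ := [SubChoice_isSubLmodule of Omega1 by <:].

Implicit Type w : Omega1.

Lemma Omega1_lact_subproof a w : outer_lact a (val w) \in in_Omega1.
Proof.
by rewrite unfold_in mult_outer_lact (eqP (valP w : mult _ == 0)) mulr0.
Qed.

Lemma Omega1_ract_subproof w a : outer_ract (val w) a \in in_Omega1.
Proof.
by rewrite unfold_in mult_outer_ract (eqP (valP w : mult _ == 0)) mul0r.
Qed.

Definition Omega1_lact a w := MkOmega1 (Omega1_lact_subproof a w).
Definition Omega1_ract w a := MkOmega1 (Omega1_ract_subproof w a).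

Lemma Omega1_lact_bilinear : bilinear_for *:%R *:%R Omega1_lact.
Proof.
split=> [w | a] k x y; apply: val_inj; rewrite [RHS]linearP.
  exact: outer_lact_bilinear.1.
exact: outer_lact_bilinear.2.
Qed.

Lemma Omega1_ract_bilinear : bilinear_for *:%R *:%R Omega1_ract.
Proof.
split=> [a | w] k x y; apply: val_inj; rewrite [RHS]linearP.
  exact: outer_ract_bilinear.1.
exact: outer_ract_bilinear.2.
Qed.

Lemma Omega1_lact1 w : Omega1_lact 1 w = w.
Proof. exact/val_inj/outer_lact1. Qed.

Lemma Omega1_ract1 w : Omega1_ract w 1 = w.
Proof. exact/val_inj/outer_ract1. Qed.

Lemma Omega1_lactM a b w :
  Omega1_lact (a * b) w = Omega1_lact a (Omega1_lact b w).
Proof. exact/val_inj/outer_lactM. Qed.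

Lemma Omega1_ractM a b w :
  Omega1_ract w (a * b) = Omega1_ract (Omega1_ract w a) b.
Proof. exact/val_inj/outer_ractM. Qed.

Lemma Omega1_lractA a b w :
  Omega1_ract (Omega1_lact a w) b = Omega1_lact a (Omega1_ract w b).
Proof. exact/val_inj/outer_lractA. Qed.

(* The kernel of mult, with the outer actions a (x ⊗ y) b = ax ⊗ yb *)
Definition Omega1_bimodule : bimodule A :=
  Bimodule Omega1_lact_bilinear Omega1_ract_bilinear Omega1_lact1 Omega1_ract1
    Omega1_lactM Omega1_ractM Omega1_lractA.

End Omega1.

Definition formally_smooth (K : fieldType) (A : algType K) : Prop :=
  rel_projective (Omega1_bimodule A).

(* A product of n elements is an arbitrary generator of the n-th power of the
   ideal, so the condition says that this power vanishes. *)
Definition nilpotent_kernel (K : fieldType) (A B : algType K)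
    (f : {lrmorphism A -> B}) : Prop :=
  exists n, forall x : 'I_n -> A, (forall i, f (x i) = 0) -> \prod_i x i = 0.

(* Main.v *)
(* Put N = ker p.  The pairing B(x, y) = lambda(x S(y)) satisfies
   x1 B(x2, y) = B(x, y1) y2, and it is invariant under the diagonal action of H
   on either side.  Hence the average f~(h) = f(h1)_0 B(f(h1)_1, h2) turns linear
   maps H -> E into colinear ones, fixes the colinear ones, and commutes with
   left and right multiplication by the values of a colinear map.
   Averaging a linear section of p gives a colinear section s, multiplicative
   modulo N.  Suppose that s is multiplicative modulo N^k.  Its curvature
   s(ab) - s(a) s(b) is then a 2-cocycle modulo N^(k+1), and projectivity of
   Omega^1 H writes it as the coboundary of some c : H -> N^k, so that s + c is
   multiplicative modulo N^(k+1).  The average of s + c is colinear and still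
   multiplicative modulo N^(k+1).  Nilpotency of N ends the process.
   For bicomodules one averages on the right, then on the left. *)

Require Import Defs.
From HB Require Import structures.
From mathcomp Require Import all_boot all_order all_algebra.
From mathcomp Require Import boolp classical_sets.

Set Implicit Arguments.
Unset Strict Implicit.
Unset Printing Implicit Defensive.

Import GRing.Theory.
Local Open Scope ring_scope.

(** * Linear maps and tensors *)

(** Zorn's lemma yields a maximal subspace on which f is injective. It maps onto W, and the inverse
    of this restriction is the section. *)
Lemma linear_section (K : fieldType) (V W : lmodType K) (f : {linear V -> W}) :
  (forall w, exists v, f v = w) -> exists2 s : W -> V, linear s & cancel s f.
Proof.
move=> f_surj.
pose P (U : set V) := [/\ U 0, forall a x y, U x -> U y -> U (a *: x + y)
  & forall x, U x -> f x = 0 -> x = 0].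
pose P' (U : set V) := (exists x, U x) -> P U.
have chainP (F : set (set V)) : (F `<=` P')%classic -> total_on F subset ->
    P' (\bigcup_(X in F) X)%classic.
  move=> FP Ftot [x0 [X0 FX0 X0x0]].
  have FP1 X x : F X -> X x -> P X by move=> FX Xx; apply: (FP _ FX); exists x.
  split.
  - by exists X0 => //; case: (FP1 _ _ FX0 X0x0).
  - move=> a x y [X FX Xx] [Y FY Yy].
    have [XY|YX] := Ftot _ _ FX FY.
      by exists Y => //; have [_ + _] := FP1 _ _ FY Yy; apply=> //; apply: XY.
    by exists X => //; have [_ + _] := FP1 _ _ FX Xx; apply=> //; apply: YX.
  - by move=> x [X FX Xx]; have [_ _] := FP1 _ _ FX Xx; apply.
have [U [P'U maxU]] := Zorn_bigcup chainP.
(* A maximal member is not empty, as {0} would be strictly larger. *)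
have PU : P U.
  apply: P'U; apply/not_existsP => U0; apply: (maxU [set 0]%classic).
    by split=> [x /U0 //|sub]; apply: (U0 0 (sub 0 erefl)).
  by move=> _; split=> // a x y -> ->; rewrite scaler0 addr0.
have [U0 Ulin Uinj] := PU.
have U_surj w : exists2 u, U u & f u = w.
  apply: contrapT => nU; have [v fv] := f_surj w.
  (* If w is not reached, adjoining to U the line through a preimage v of w keeps f injective,
     against maximality. *)
  pose U' : set V := [set x | exists a, exists2 u, U u & x = a *: v + u]%classic.
  apply: (maxU U'); last first.
    move=> _; split.
    - by exists 0, 0 => //; rewrite scale0r addr0.
    - move=> c _ _ [a [u Uu ->]] [b [u' Uu' ->]].
      exists (c * a + b), (c *: u + u'); first exact: Ulin.
      by rewrite scalerDr scalerA scalerDl addrACA.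
    - move=> _ [a [u Uu ->]]; rewrite linearP fv /=.
      have [->|a0] := eqVneq a 0; first by rewrite !scale0r !add0r; apply: Uinj.
      move=> /eqP; rewrite addr_eq0 => /eqP aw; case: nU.
      exists ((- a^-1) *: u + 0); first exact: Ulin.
      by rewrite addr0 linearZ /= scaleNr -scalerN -aw scalerA mulVf ?scale1r.
  split=> [u Uu|sub]; first by exists 0, u; rewrite // scale0r add0r.
  apply: nU; exists v => //; apply: sub; exists 1, 0 => //.
  by rewrite scale1r addr0.
have U_surjT w : exists u, U u /\ f u = w by have [u] := U_surj w; exists u.
have [s sP] := choice U_surjT.
exists s; last by move=> w; have [] := sP w.
move=> a x y.
apply/eqP; rewrite -subr_eq0; apply/eqP; apply: Uinj.
  have := Ulin (- 1) _ _ (Ulin a _ _ (sP x).1 (sP y).1) (sP (a *: x + y)).1.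
  by rewrite scaleN1r [- _ + _]addrC.
by rewrite linearB linearP !(sP _).2 subrr.
Qed.

Section LinearClosure.
Variable K : fieldType.
Implicit Types U V W X : lmodType K.

Definition linear_pack U V (f : U -> V) (fl : linear f) : {linear U -> V} :=
  HB.pack f (GRing.isLinear.Build _ _ _ _ f fl).

Lemma lin0 U V (f : U -> V) : linear f -> f 0 = 0.
Proof. by move=> fl; apply: (linear0 (linear_pack fl)). Qed.

Lemma linZ U V (f : U -> V) a x : linear f -> f (a *: x) = a *: f x.
Proof. by move=> fl; apply: (linearZ_LR (linear_pack fl)). Qed.

Lemma linB U V (f : U -> V) x y : linear f -> f (x - y) = f x - f y.
Proof. by move=> fl; apply: (linearB (linear_pack fl)). Qed.

Lemma linD U V (f : U -> V) x y : linear f -> f (x + y) = f x + f y.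
Proof. by move=> fl; apply: (linearD (linear_pack fl)). Qed.

Lemma lin_id U : linear (fun x : U => x). Proof. by []. Qed.

Lemma lin_comp U V W (g : V -> W) (f : U -> V) :
  linear g -> linear f -> linear (fun x => g (f x)).
Proof. by move=> gl fl k x y; rewrite fl gl. Qed.

Lemma lin_scalar U V (g : {scalar V}) (f : U -> V) :
  linear f -> linear ((fun x => g (f x)) : U -> K^o).
Proof. by move=> fl k x y; rewrite fl linearP. Qed.

Lemma lin_add U V (f g : U -> V) :
  linear f -> linear g -> linear (fun x => f x + g x).
Proof. by move=> fl gl k x y; rewrite fl gl scalerDr addrACA. Qed.

Lemma lin_opp U V (f : U -> V) : linear f -> linear (fun x => - f x).
Proof. by move=> fl k x y; rewrite fl scalerN opprD. Qed.

Lemma lin_mull U (A : algType K) (f : U -> A) c :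
  linear f -> linear (fun x => c * f x).
Proof. by move=> fl k x y; rewrite fl mulrDr scalerAr. Qed.

Lemma lin_mulr U (A : algType K) (f : U -> A) c :
  linear f -> linear (fun x => f x * c).
Proof. by move=> fl k x y; rewrite fl mulrDl scalerAl. Qed.

Lemma lin_tensl U V W (f : U -> V) (w : W) :
  linear f -> linear (fun x => f x ⊗ w).
Proof. by move=> fl k x y; rewrite fl tensDl tensZl. Qed.

Lemma lin_tensr U V W (f : U -> W) (v : V) :
  linear f -> linear (fun x => v ⊗ f x).
Proof. by move=> fl k x y; rewrite fl tensDr tensZr. Qed.

Lemma lin_scaler U V (f : U -> V) a :
  linear f -> linear (fun x => a *: f x).
Proof. by move=> fl k x y; rewrite fl scalerDr !scalerA mulrC. Qed.

Lemma lin_scalel U V (f : U -> K^o) (v : V) :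
  linear f -> linear (fun x => (f x : K) *: v).
Proof. by move=> fl k x y; rewrite fl scalerDl -scalerA. Qed.

(** For a fixed tensor, [tlift] is a finite sum over one chosen representative, so linearity in a
    parameter is checked term by term. *)
Lemma lin_tlift_body U V W X (F : U -> V -> W -> X) t :
  (forall v w, linear (fun x => F x v w)) -> linear (fun x => tlift (F x) t).
Proof.
move=> Fl k x y; rewrite /tlift scaler_sumr -big_split /=.
by apply: eq_bigr => p _; apply: Fl.
Qed.

Lemma bilinearP V W X (F : V -> W -> X) :
  (forall w, linear (fun v => F v w)) -> (forall v, linear (fun w => F v w)) ->
  bilinear_for *:%R *:%R F.
Proof. by split. Qed.

Lemma lin_tlift_arg U V W X (F : V -> W -> X) (f : U -> V ⊗[K] W) :
  (forall w, linear (fun v => F v w)) -> (forall v, linear (fun w => F v w)) ->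
  linear f -> linear (fun x => tlift F (f x)).
Proof. by move=> F1 F2 fl k x y; rewrite fl (tlift_is_linear (bilinearP F1 F2)). Qed.

Lemma lin_tmap V V' W W' U (f : V -> V') (g : W -> W') (h : U -> V ⊗[K] W) :
  linear f -> linear g -> linear h -> linear (fun x => tmap f g (h x)).
Proof. by move=> fl gl hl k x y; rewrite hl tmap_is_linear. Qed.

End LinearClosure.

(** Discharges the linearity side conditions of the Sweedler calculus by descending through the
    expression down to the variable. *)
Ltac lin :=
  intros;
  (* The patterns below do not match eta-reduced functions. *)
  lazymatch goal with
    |- GRing.linear_for ?s ?f => change (GRing.linear_for s (fun x => f x))
  end; cbv beta;
  lazymatch goal with
  | |- GRing.linear_for _ (fun x => x) => exact: lin_id
  | |- GRing.linear_for _ (fun x => _ + _) => apply: lin_add; lin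
  | |- GRing.linear_for _ (fun x => - _) => apply: lin_opp; lin
  | |- GRing.linear_for _ (fun x => _ * _) =>
      first [apply: lin_mull | apply: lin_mulr]; lin
  | |- GRing.linear_for _ (fun x => _ ⊗ _) =>
      first [apply: lin_tensr | apply: lin_tensl]; lin
  | |- GRing.linear_for _ (fun x => _ *: _) =>
      first [apply: lin_scaler | apply: lin_scalel]; lin
  | |- GRing.linear_for _ (fun x => tlift _ _) =>
      first [apply: lin_tlift_body | apply: lin_tlift_arg]; lin
  | |- GRing.linear_for _ (fun x => tmap _ _ _) => apply: lin_tmap; lin
  | |- _ => first
      [ solve [auto]
      | exact: linearP
      | apply: lin_scalar; lin
      | match goal with
        | |- GRing.linear_for _ (fun x => ?g (@?f x)) =>
            apply: (@lin_comp _ _ _ _ g f); [first [solve [auto] | exact: linearP] | lin]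
        | |- GRing.linear_for _ (fun x => ?B (@?f x) ?c) =>
            apply: (@lin_comp _ _ _ _ (fun z => B z c) f); [solve [auto] | lin]
        end ]
  end.

(** * Sweedler calculus *)

Section Sweedler.
Variable K : fieldType.
Implicit Types U V W X : lmodType K.

Lemma eq_tlift V W X (F G : V -> W -> X) t :
  (forall v w, F v w = G v w) -> tlift F t = tlift G t.
Proof. by move=> FG; apply: eq_bigr => p _; apply: FG. Qed.

Lemma map_tlift V W X U (f : X -> U) (F : V -> W -> X) t : linear f ->
  f (tlift F t) = tlift (fun v w => f (F v w)) t.
Proof.
by move=> fl; rewrite -[f]/(linear_pack fl : _ -> _) linear_sum.
Qed.

Lemma tliftE V W X (F : V -> W -> X) v w :
  (forall w, linear (fun v => F v w)) -> (forall v, linear (fun w => F v w)) ->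
  tlift F (v ⊗ w) = F v w.
Proof. by move=> F1 F2; rewrite (tlift_tens (bilinearP F1 F2)). Qed.

Lemma tlift_tmap V V' W W' X (F : V' -> W' -> X) (f : V -> V') (g : W -> W') t :
  (forall w, linear (fun v => F v w)) -> (forall v, linear (fun w => F v w)) ->
  linear f -> linear g ->
  tlift F (tmap f g t) = tlift (fun v w => F (f v) (g w)) t.
Proof.
move=> F1 F2 fl gl; rewrite /tmap (map_tlift (f := tlift F)); last lin.
apply: eq_tlift => v w; rewrite tliftE; [by []|lin..].
Qed.

Lemma tlift_id V W (t : V ⊗[K] W) : tlift (fun v w => v ⊗ w) t = t.
Proof. by rewrite [RHS]tensor_sum. Qed.

Lemma tlift_exchange V W V' W' X (F : V -> W -> V' -> W' -> X) t t' :
  tlift (fun v w => tlift (fun v' w' => F v w v' w') t') t =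
  tlift (fun v' w' => tlift (fun v w => F v w v' w') t) t'.
Proof. exact: exchange_big. Qed.

Lemma tlift_tassoc V1 V2 V3 X (F : V1 -> V2 -> V3 -> X) t :
  (forall b c, linear (fun a => F a b c)) ->
  (forall a c, linear (fun b => F a b c)) ->
  (forall a b, linear (fun c => F a b c)) ->
  tlift (fun a y => tlift (fun b c => F a b c) y) (tassoc t) =
  tlift (fun y c => tlift (fun a b => F a b c) y) t.
Proof.
move=> F1 F2 F3; rewrite /tassoc map_tlift; last by lin.
apply: eq_tlift => y c; rewrite map_tlift; last by lin.
apply: eq_tlift => a b; rewrite !tliftE; [by []|lin..].
Qed.

Lemma tlift_tmul (A B : algType K) X (F : A -> B -> X) (x y : A ⊗[K] B) :
  (forall b, linear (fun a => F a b)) -> (forall a, linear (fun b => F a b)) ->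
  tlift F (tmul x y) =
  tlift (fun a b => tlift (fun a' b' => F (a * a') (b * b')) y) x.
Proof.
move=> F1 F2; rewrite /tmul tlift_tmap //; [|lin..].
rewrite /tinterchange tliftE; [|lin..].
rewrite map_tlift; last lin.
apply: eq_tlift => a b; rewrite map_tlift; last lin.
by apply: eq_tlift => a' b'; rewrite tliftE; [rewrite !mult_tens|lin..].
Qed.

End Sweedler.

(** * The invariant pairing of an ad-invariant integral *)

Section HopfCalculus.
Variables (K : fieldType) (H : hopfAlgType K).
Implicit Types (X : lmodType K) (x y h : H).

Lemma coassoc_tlift X (F : H -> H -> H -> X) h :
  (forall b c, linear (fun a => F a b c)) ->
  (forall a c, linear (fun b => F a b c)) ->
  (forall a b, linear (fun c => F a b c)) ->
  tlift (fun a b => tlift (fun a1 a2 => F a1 a2 b) (comul a)) (comul h) =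
  tlift (fun a b => tlift (fun b1 b2 => F a b1 b2) (comul b)) (comul h).
Proof.
move=> F1 F2 F3.
have := congr1 (tlift (fun a => tlift (F a))) (comulA h).
rewrite tlift_tassoc; [|lin..].
rewrite tlift_tmap; [|lin..].
by rewrite tlift_tmap; [|lin..].
Qed.

Lemma counitl_tlift X (f : H -> X) h : linear f ->
  tlift (fun a b => counit a *: f b) (comul h) = f h.
Proof.
move=> fl; rewrite -[in RHS](comul_counitl h) (map_tlift _ _ fl).
by apply: eq_tlift => a b; rewrite linZ.
Qed.

Lemma counitr_tlift X (f : H -> X) h : linear f ->
  tlift (fun a b => counit b *: f a) (comul h) = f h.
Proof.
move=> fl; rewrite -[in RHS](comul_counitr h) (map_tlift _ _ fl).
by apply: eq_tlift => a b; rewrite linZ.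
Qed.

Lemma antipodel_tlift X (f : H -> X) h : linear f ->
  tlift (fun a b => f (antipode a * b)) (comul h) = counit h *: f 1.
Proof.
by move=> fl; rewrite -linZ // -antipodel (map_tlift _ _ fl).
Qed.

Lemma antipoder_tlift X (f : H -> X) h : linear f ->
  tlift (fun a b => f (a * antipode b)) (comul h) = counit h *: f 1.
Proof.
by move=> fl; rewrite -linZ // -antipoder (map_tlift _ _ fl).
Qed.

Lemma comulM_tlift X (F : H -> H -> X) x y :
  (forall b, linear (fun a => F a b)) -> (forall a, linear (fun b => F a b)) ->
  tlift F (comul (x * y)) =
  tlift (fun a b => tlift (fun a' b' => F (a * a') (b * b')) (comul y)) (comul x).
Proof. by move=> F1 F2; rewrite comulM tlift_tmul. Qed.

(* Both sides equal S(h1 y1) h2 y2 S(y3) S(h3). *)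
Lemma antipodeM h y : antipode (h * y) = antipode y * antipode h.
Proof.
pose S := @antipode K H.
transitivity (tlift (fun h1 h2 => tlift (fun h21 h22 =>
    tlift (fun y1 y2 => tlift (fun y21 y22 =>
      S (h1 * y1) * (h21 * (y21 * S y22) * S h22))
    (comul y2)) (comul y)) (comul h2)) (comul h)).
  (* On the left-hand side: y2 S(y3) collapses first, then h2 S(h3), which leaves S(h y). *)
  rewrite -(counitr_tlift (f := fun h1 => S (h1 * y))); last lin.
  apply: eq_tlift => h1 h2; rewrite -[S _]mulr1.
  rewrite -(antipoder_tlift (f := fun z => S (h1 * y) * z)); last lin.
  apply: eq_tlift => h21 h22.
  rewrite -(counitr_tlift (f := fun y1 => S (h1 * y1) * _)); last lin.
  apply: eq_tlift => y1 y2.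
  rewrite (antipoder_tlift (f := fun z => S (h1 * y1) * (h21 * z * S h22))); last lin.
  by rewrite mulr1.
(* On the right-hand side: after regrouping, S(h1 y1) h2 y2 is S(u1) u2 for products u = hy, and
   collapses to the counit. *)
rewrite -(coassoc_tlift (F := fun h1 h21 h22 => tlift (fun y1 y2 => tlift (fun y21 y22 =>
      S (h1 * y1) * (h21 * (y21 * S y22) * S h22))
    (comul y2)) (comul y))); [|lin..].
rewrite -[RHS](counitl_tlift (f := fun h2 => S y * S h2)); last lin.
apply: eq_tlift => h1 h2.
rewrite -(counitl_tlift (f := fun y2 => S y2 * S h2)); last lin.
rewrite (map_tlift (f := fun z => counit h1 *: z)); last lin.
under eq_tlift => a b.
  rewrite -(coassoc_tlift (F := fun y1 y21 y22 =>
    S (a * y1) * (b * (y21 * S y22) * S h2))); [|lin..].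
  over.
rewrite tlift_exchange; apply: eq_tlift => y1 y2.
transitivity (tlift (fun a b => tlift (fun a' b' =>
    S (a * a') * (b * b') * (S y2 * S h2)) (comul y1)) (comul h1)).
  by apply: eq_tlift => a b; apply: eq_tlift => a' b'; rewrite !mulrA.
rewrite -(comulM_tlift (F := fun a b => S a * b * (S y2 * S h2))); [|lin..].
rewrite (antipodel_tlift (f := fun z => z * (S y2 * S h2))); last lin.
by rewrite counitM mul1r scalerA.
Qed.

(* x ⊗ y |-> x y1 ⊗ y2 is bijective on H ⊗ H, with inverse x S(y1) ⊗ y2. *)
Lemma galois_ext X (F G : H -> H -> X) :
  (forall y, linear (fun x => F x y)) -> (forall x, linear (fun y => F x y)) ->
  (forall y, linear (fun x => G x y)) -> (forall x, linear (fun y => G x y)) ->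
  (forall z y, tlift (fun y1 y2 => F (z * y1) y2) (comul y) =
               tlift (fun y1 y2 => G (z * y1) y2) (comul y)) ->
  forall x y, F x y = G x y.
Proof.
move=> F1 F2 G1 G2 FG x y.
(* Any bilinear T satisfies T(x, y) = T(x S(y1) y2, y3), so it is determined by the values compared
   in the last hypothesis. *)
have key (T : H -> H -> X) :
    (forall y, linear (fun x => T x y)) -> (forall x, linear (fun y => T x y)) ->
    T x y = tlift (fun y1 y2 => tlift (fun y21 y22 =>
      T (x * antipode y1 * y21) y22) (comul y2)) (comul y).
  move=> T1 T2.
  rewrite -(coassoc_tlift (F := fun y1 y21 y22 => T (x * antipode y1 * y21) y22)); [|lin..].
  rewrite -(counitl_tlift (f := fun y2 => T x y2)); last lin.
  apply: eq_tlift => y1 y2; rewrite -[in LHS](mulr1 x).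
  rewrite -(antipodel_tlift (f := fun z => T (x * z) y2)); last lin.
  by apply: eq_tlift => y11 y12; rewrite mulrA.
rewrite (key F) // (key G) //; apply: eq_tlift => y1 y2; exact: FG.
Qed.

End HopfCalculus.

(** What averaging uses about the comultiplication and the pairing, freed from counit and antipode
    so as to cover the co-opposite comultiplication too. Laws in which a counit would appear, such
    as B(h1, h2) = ε(h), are stated with one more Sweedler factor h0 carried along. *)
Record invariant_pairing (K : fieldType) (H : algType K)
    (delta : {linear H -> H ⊗[K] H}) (B : H -> H -> K^o) : Prop :=
  InvariantPairing {
  ip_coassoc : forall (X : lmodType K) (F : H -> H -> H -> X) h,
    (forall b c, linear (fun a => F a b c)) ->
    (forall a c, linear (fun b => F a b c)) ->
    (forall a b, linear (fun c => F a b c)) ->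
    tlift (fun a b => tlift (fun a1 a2 => F a1 a2 b) (delta a)) (delta h) =
    tlift (fun a b => tlift (fun b1 b2 => F a b1 b2) (delta b)) (delta h);
  ip_comulM : forall (X : lmodType K) (F : H -> H -> X) x y,
    (forall b, linear (fun a => F a b)) -> (forall a, linear (fun b => F a b)) ->
    tlift F (delta (x * y)) =
    tlift (fun a b => tlift (fun a' b' => F (a * a') (b * b')) (delta y)) (delta x);
  ip_comul1 : delta 1 = 1 ⊗ 1;
  ip_linl : forall y, linear (fun x => B x y);
  ip_linr : forall x, linear (fun y => B x y);
  ip_slide : forall x y,
    tlift (fun x1 x2 => (B x2 y : K) *: x1) (delta x) =
    tlift (fun y1 y2 => (B x y1 : K) *: y2) (delta y);
  ip_diag : forall (X : lmodType K) (f : H -> X) h, linear f ->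
    tlift (fun h0 h => tlift (fun h1 h2 => (B h1 h2 : K) *: f h0) (delta h)) (delta h)
      = f h;
  ip_actl : forall (X : lmodType K) (f : H -> X) x y h, linear f ->
    tlift (fun h0 h => tlift (fun h1 h2 => (B (h1 * x) (h2 * y) : K) *: f h0) (delta h))
      (delta h) = (B x y : K) *: f h;
  ip_actr : forall (X : lmodType K) (f : H -> X) x y h, linear f ->
    tlift (fun h0 h => tlift (fun h1 h2 => (B (x * h1) (y * h2) : K) *: f h0) (delta h))
      (delta h) = (B x y : K) *: f h
}.

Definition tflip (K : fieldType) (V W : lmodType K) : V ⊗[K] W -> W ⊗[K] V :=
  tlift (fun v w => w ⊗ v).

Lemma tflip_linear (K : fieldType) (V W : lmodType K) : linear (@tflip K V W).
Proof. by rewrite /tflip; lin. Qed.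

Lemma tlift_tflip (K : fieldType) (V W X : lmodType K) (F : W -> V -> X)
    (t : V ⊗[K] W) :
  (forall b, linear (fun a => F a b)) -> (forall a, linear (fun b => F a b)) ->
  tlift F (tflip t) = tlift (fun v w => F w v) t.
Proof.
move=> F1 F2; rewrite /tflip map_tlift; last lin.
by apply: eq_tlift => v w; rewrite tliftE; [|lin..].
Qed.

Lemma tflipK (K : fieldType) (V W : lmodType K) : cancel (@tflip K V W) (@tflip K W V).
Proof. by move=> t; rewrite {1}/tflip tlift_tflip; [rewrite tlift_id|lin..]. Qed.

Section IntegralPairing.
Variables (K : fieldType) (H : hopfAlgType K) (lambda : {scalar H}).
Hypothesis lambdaP : ad_invariant_integral lambda.

Definition integral_pairing (x y : H) : K^o := lambda (x * antipode y).
Local Notation B := integral_pairing.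

Let lambda_lin : linear (lambda : H -> K^o).
Proof. exact: linearP. Qed.

Lemma integral_pairing_linl y : linear (fun x => B x y).
Proof. by rewrite /B; lin. Qed.

Lemma integral_pairing_linr x : linear (fun y => B x y).
Proof. by rewrite /B; lin. Qed.
#[local] Hint Resolve integral_pairing_linl integral_pairing_linr : core.

Lemma integral_pairing_diag h :
  tlift (fun h1 h2 => B h1 h2) (comul h) = counit h.
Proof.
have [_ _ l1] := lambdaP; rewrite /B (antipoder_tlift (f := lambda : H -> K^o)) //.
by rewrite l1 /GRing.scale /= mulr1.
Qed.

(** Since S is antimultiplicative, the argument of λ is h1 (x S(y)) S(h2), and ad-invariance
    applies. *)
Lemma integral_pairing_actl x y h :
  tlift (fun h1 h2 => B (h1 * x) (h2 * y)) (comul h) = counit h *: B x y.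
Proof.
have [_ l2 _] := lambdaP; rewrite -[RHS]/(counit h * lambda (x * antipode y)) -l2.
by apply: eq_tlift => h1 h2; rewrite /B antipodeM !mulrA.
Qed.

(** Here h1 S(h2) appears in the middle of x h1 S(h2) S(y) and collapses to the counit. *)
Lemma integral_pairing_actr x y h :
  tlift (fun h1 h2 => B (x * h1) (y * h2)) (comul h) = counit h *: B x y.
Proof.
rewrite -{2}(mulr1 x) -[RHS](antipoder_tlift (f := fun z => B (x * z) y)); last lin.
by apply: eq_tlift => h1 h2; rewrite /B antipodeM !mulrA.
Qed.

(** By [galois_ext] it suffices to treat x ⊗ y = z h1 ⊗ h2. The antipode then collapses the left
    side to z1 λ(z2) h and the right side to λ(z) h; these agree by the first axiom of the
    integral. *)
Lemma integral_pairing_slide x y :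
  tlift (fun x1 x2 => (B x2 y : K) *: x1) (comul x) =
  tlift (fun y1 y2 => (B x y1 : K) *: y2) (comul y).
Proof.
have [l1 _ _] := lambdaP.
apply: (galois_ext (F := fun x y => tlift (fun x1 x2 => (B x2 y : K) *: x1) (comul x))
  (G := fun x y => tlift (fun y1 y2 => (B x y1 : K) *: y2) (comul y)));
  [lin..|move=> z h].
transitivity (lambda z *: h).
  transitivity (tlift (fun z1 z2 => tlift (fun h1 h2 => tlift (fun h11 h12 =>
      (B (z2 * h12) h2 : K) *: (z1 * h11)) (comul h1)) (comul h)) (comul z)).
    rewrite tlift_exchange; apply: eq_tlift => h1 h2.
    by rewrite comulM_tlift; [|lin..].
  rewrite -[h in RHS]mul1r scalerAl -l1 [RHS](map_tlift (f := fun u => u * h)); last lin.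
  apply: eq_tlift => z1 z2.
  rewrite (coassoc_tlift (F := fun h11 h12 h2 => (B (z2 * h12) h2 : K) *: (z1 * h11)));
    [|lin..].
  rewrite -[RHS](counitr_tlift (f := fun h1 => lambda z2 *: z1 * h1)); last lin.
  apply: eq_tlift => h1 h2; rewrite /B.
  transitivity (tlift (fun h21 h22 => (lambda (z2 * (h21 * antipode h22))) *: (z1 * h1))
    (comul h2)).
    by apply: eq_tlift => h21 h22; rewrite mulrA.
  rewrite (antipoder_tlift (f := fun u => (lambda (z2 * u) *: (z1 * h1)))); last lin.
  by rewrite mulr1 scalerAl.
rewrite -(coassoc_tlift (F := fun h1 h21 h22 => (B (z * h1) h21 : K) *: h22)); [|lin..].
rewrite -(counitl_tlift (f := fun u => lambda z *: u)); last lin.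
apply: eq_tlift => h1 h2; rewrite /B.
transitivity (tlift (fun h11 h12 => lambda (z * (h11 * antipode h12)) *: h2) (comul h1)).
  by rewrite (antipoder_tlift (f := fun u => (lambda (z * u) *: h2))) ?mulr1; last lin.
by apply: eq_tlift => h11 h12; rewrite mulrA.
Qed.

Lemma comul_invariant_pairing : invariant_pairing comul B.
Proof.
have scaleK (X : lmodType K) (v : X) : linear (fun k : K^o => (k : K) *: v).
  exact: (lin_scalel v (@lin_id _ _)).
split=> [X F h F1 F2 F3|X F x y F1 F2|||||X f h fl|X f x y h fl|X f x y h fl].
- exact: coassoc_tlift.
- exact: comulM_tlift.
- exact: comul1.
- exact: integral_pairing_linl.
- exact: integral_pairing_linr.
- exact: integral_pairing_slide.
- rewrite -[RHS](counitr_tlift (f := f)) //; apply: eq_tlift => h0 h1.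
  by rewrite -(map_tlift _ _ (scaleK _ (f h0))) integral_pairing_diag.
- rewrite -[RHS](counitr_tlift (f := fun h => (B x y : K) *: f h)); last lin.
  apply: eq_tlift => h0 h1.
  by rewrite -(map_tlift _ _ (scaleK _ (f h0))) integral_pairing_actl scalerA.
- rewrite -[RHS](counitr_tlift (f := fun h => (B x y : K) *: f h)); last lin.
  apply: eq_tlift => h0 h1.
  by rewrite -(map_tlift _ _ (scaleK _ (f h0))) integral_pairing_actr scalerA.
Qed.

Definition coop_comul : {linear H -> H ⊗[K] H} :=
  linear_pack (lin_comp (@tflip_linear K H H) (linearP (@comul K H))).

Lemma tlift_coop (X : lmodType K) (F : H -> H -> X) x :
  (forall b, linear (fun a => F a b)) -> (forall a, linear (fun b => F a b)) ->
  tlift F (coop_comul x) = tlift (fun a b => F b a) (comul x).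
Proof. exact: tlift_tflip. Qed.

(* The co-opposite comultiplication turns left coactions into right ones. *)
Lemma coop_invariant_pairing : invariant_pairing coop_comul (fun x y => B y x).
Proof.
have scaleK (X : lmodType K) (v : X) : linear (fun k : K^o => (k : K) *: v).
  exact: (lin_scalel v (@lin_id _ _)).
split=> [X F h F1 F2 F3|X F x y F1 F2||x|x|x y|X f h fl|X f x y h fl|X f x y h fl].
- rewrite !tlift_coop; [|lin..].
  under eq_tlift => a b do (rewrite tlift_coop; [|lin..]).
  under [RHS]eq_tlift => a b do (rewrite tlift_coop; [|lin..]).
  exact/esym/(coassoc_tlift (F := fun a b c => F c b a)).
- rewrite tlift_coop; [|lin..]; rewrite comulM_tlift; [|lin..].
  rewrite tlift_coop; [|lin..].
  by apply: eq_tlift => a b; rewrite tlift_coop; [|lin..].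
- by rewrite /= /tflip comul1 tliftE; [|lin..].
- exact: integral_pairing_linr.
- exact: integral_pairing_linl.
(* Exchanging the arguments of the pairing together with the tensor factors turns the sliding
   identity into itself, read backwards. *)
- rewrite !tlift_coop; [|lin..]; exact/esym/integral_pairing_slide.
- rewrite tlift_coop; [|lin..].
  rewrite -[RHS](counitl_tlift (f := f)) //; apply: eq_tlift => h1 h0.
  rewrite tlift_coop; [|lin..].
  by rewrite -(map_tlift _ _ (scaleK _ (f h0))) integral_pairing_diag.
- rewrite tlift_coop; [|lin..].
  rewrite -[RHS](counitl_tlift (f := fun h => (B y x : K) *: f h)); last lin.
  apply: eq_tlift => h1 h0; rewrite tlift_coop; [|lin..].
  by rewrite -(map_tlift _ _ (scaleK _ (f h0))) integral_pairing_actl scalerA.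
- rewrite tlift_coop; [|lin..].
  rewrite -[RHS](counitl_tlift (f := fun h => (B y x : K) *: f h)); last lin.
  apply: eq_tlift => h1 h0; rewrite tlift_coop; [|lin..].
  by rewrite -(map_tlift _ _ (scaleK _ (f h0))) integral_pairing_actr scalerA.
Qed.

End IntegralPairing.

(** * Averaging *)

Section Averaging.
Variables (K : fieldType) (H : algType K).
Variables (delta : {linear H -> H ⊗[K] H}) (B : H -> H -> K^o).
Hypothesis BP : invariant_pairing delta B.
Let Bl := ip_linl BP.
Let Br := ip_linr BP.
#[local] Hint Resolve Bl Br : core.

Section Comodule.
Variables (E : lmodType K) (r : {linear E -> E ⊗[K] H}).
Hypothesis r_coassoc : forall (X : lmodType K) (F : E -> H -> H -> X) e,
    (forall b c, linear (fun a => F a b c)) ->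
    (forall a c, linear (fun b => F a b c)) ->
    (forall a b, linear (fun c => F a b c)) ->
    tlift (fun a b => tlift (fun a1 a2 => F a1 a2 b) (r a)) (r e) =
    tlift (fun a b => tlift (fun b1 b2 => F a b1 b2) (delta b)) (r e).

Definition slice (h : H) (t : E ⊗[K] H) : E :=
  tlift (fun e h' => (B h' h : K) *: e) t.

Lemma slice_linear h : linear (slice h).
Proof. by rewrite /slice; lin. Qed.

Lemma slice_linearl t : linear (fun h => slice h t).
Proof. by rewrite /slice; lin. Qed.
#[local] Hint Resolve slice_linear slice_linearl : core.

Definition average (f : H -> E) (h : H) : E :=
  tlift (fun h0 h1 => slice h1 (r (f h0))) (delta h).

Lemma average_linear f : linear f -> linear (average f).
Proof. by move=> fl; rewrite /average; lin. Qed.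

(** With e = f(h1), coassociativity of the coaction gives e0 ⊗ e1 B(e2, h2), and sliding turns this
    into e0 B(e1, h2) ⊗ h3. *)
Lemma average_colinear f : linear f ->
  forall h, r (average f h) = tmap (average f) id (delta h).
Proof.
move=> fl h; rewrite /average map_tlift; last lin.
transitivity (tlift (fun h0 h1 => tlift (fun e c => tlift (fun c1 c2 =>
   (B c2 h1 : K) *: (e ⊗ c1)) (delta c)) (r (f h0))) (delta h)).
  apply: eq_tlift => h0 h1; rewrite /slice map_tlift; last lin.
  rewrite -(r_coassoc (F := fun e c1 c2 => (B c2 h1 : K) *: (e ⊗ c1))); [|lin..].
  apply: eq_tlift => e c; rewrite linearZ_LR -{1}[r e]tlift_id.
  by rewrite (map_tlift (f := fun z => (B c h1 : K) *: z)); last lin.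
rewrite /tmap /average.
transitivity (tlift (fun h0 h1 => tlift (fun h01 h02 =>
    slice h02 (r (f h01)) ⊗ h1) (delta h0)) (delta h)); last first.
  by apply: eq_tlift => h0 h1; rewrite (map_tlift (f := fun z => z ⊗ h1)); last lin.
rewrite (ip_coassoc BP (F := fun h00 h01 h1 => slice h01 (r (f h00)) ⊗ h1)); [|lin..].
apply: eq_tlift => h0 h1.
transitivity (tlift (fun h11 h12 => tlift (fun e c => ((B c h11 : K) *: e) ⊗ h12)
   (r (f h0))) (delta h1)); last first.
  by apply: eq_tlift => h11 h12; rewrite (map_tlift (f := fun z => z ⊗ h12)); last lin.
rewrite tlift_exchange; apply: eq_tlift => e c.
transitivity (e ⊗ tlift (fun c1 c2 => (B c2 h1 : K) *: c1) (delta c)).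
  rewrite (map_tlift (f := fun z => e ⊗ z)); last lin.
  by apply: eq_tlift => c1 c2; rewrite tensZr.
rewrite (ip_slide BP) (map_tlift (f := fun z => e ⊗ z)); last lin.
by apply: eq_tlift => c1 c2; rewrite tensZr tensZl.
Qed.

(** For colinear f the average is f(h1) B(h2, h3), which is f(h) by [ip_diag]. *)
Lemma average_fix f : linear f -> (forall h, r (f h) = tmap f id (delta h)) ->
  average f =1 f.
Proof.
move=> fl fr h; rewrite -[RHS](ip_diag BP h fl) /average.
rewrite -(ip_coassoc BP (F := fun h0 h1 h2 => (B h1 h2 : K) *: f h0)); [|lin..].
apply: eq_tlift => h0 h1; rewrite fr /slice tlift_tmap //; lin.
Qed.

(** The average with respect to the codiagonal coaction on H ⊗ H: F(x1, y1)_0 B(F(x1, y1)_1, x2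
    y2). *)
Definition average2 (F : H -> H -> E) (x y : H) : E :=
  tlift (fun x0 x1 => tlift (fun y0 y1 => slice (x1 * y1) (r (F x0 y0))) (delta y))
    (delta x).

Lemma average2_mul f x y : linear f ->
  average2 (fun x y => f (x * y)) x y = average f (x * y).
Proof. by move=> fl; rewrite /average (ip_comulM BP); [|lin..]. Qed.

End Comodule.

(** Averaging is natural in the comodule; applied to p this shows that averages of sections are
    sections. *)
Lemma average_map (V W : lmodType K) (rV : {linear V -> V ⊗[K] H})
    (rW : {linear W -> W ⊗[K] H}) (p : V -> W) (f : H -> V) h :
  linear p -> linear f -> (forall v, rW (p v) = tmap p id (rV v)) ->
  p (average rV f h) = average rW (fun h => p (f h)) h.
Proof.
move=> pl fl pr; rewrite /average map_tlift //; apply: eq_tlift => h0 h1.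
rewrite /slice pr tlift_tmap //; [|lin..]; rewrite map_tlift //.
by apply: eq_tlift => v c; rewrite linZ.
Qed.

Section ComoduleAlgebra.
Variables (E : algType K) (r : {linear E -> E ⊗[K] H}).
Hypothesis rM : forall (X : lmodType K) (F : E -> H -> X) x y,
  (forall b, linear (fun a => F a b)) -> (forall a, linear (fun b => F a b)) ->
  tlift F (r (x * y)) =
  tlift (fun a b => tlift (fun a' b' => F (a * a') (b * b')) (r y)) (r x).
Variable s : H -> E.
Hypotheses (sl : linear s) (sr : forall h, r (s h) = tmap s id (delta h)).
Let slice_lin := @slice_linear E.
Let slice_linl := @slice_linearl E.
#[local] Hint Resolve slice_lin slice_linl : core.

(** Colinearity of s makes the pairing B(x2 c, x3 y2), with c the coaction factor of f(y1); left
    invariance removes x2 and x3. *)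
Lemma average2_mull f x y : linear f ->
  average2 r (fun x y => s x * f y) x y = s x * average r f y.
Proof.
move=> fl; rewrite /average2 /average tlift_exchange map_tlift; last lin.
apply: eq_tlift => y0 y1; rewrite /slice map_tlift; last lin.
transitivity (tlift (fun x0 x1 => tlift (fun x01 x02 => tlift (fun e c =>
    (B (x02 * c) (x1 * y1) : K) *: (s x01 * e)) (r (f y0))) (delta x0)) (delta x)).
  apply: eq_tlift => x0 x1; rewrite rM; [|lin..].
  by rewrite sr tlift_tmap; [|lin..].
rewrite (ip_coassoc BP (F := fun x0 x1 x2 => tlift (fun e c =>
    (B (x1 * c) (x2 * y1) : K) *: (s x0 * e)) (r (f y0)))); [|lin..].
under eq_tlift => a b do rewrite tlift_exchange.
rewrite tlift_exchange; apply: eq_tlift => e c.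
rewrite (ip_actl BP (f := fun x0 => s x0 * e)); last lin.
by rewrite scalerAr.
Qed.

(** The mirror computation: the pairing is B(c y2, x2 y3), with c coming from f(x1), and right
    invariance removes y2 and y3. *)
Lemma average2_mulr f x y : linear f ->
  average2 r (fun x y => f x * s y) x y = average r f x * s y.
Proof.
move=> fl; rewrite /average2 /average [RHS](map_tlift (f := fun z => z * s y)); last lin.
apply: eq_tlift => x0 x1; rewrite /slice [RHS](map_tlift (f := fun z => z * s y)); last lin.
transitivity (tlift (fun y0 y1 => tlift (fun y01 y02 => tlift (fun e c =>
    (B (c * y02) (x1 * y1) : K) *: (e * s y01)) (r (f x0))) (delta y0)) (delta y)).
  apply: eq_tlift => y0 y1; rewrite rM; [|lin..]; rewrite tlift_exchange.
  by rewrite sr tlift_tmap; [|lin..].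
rewrite (ip_coassoc BP (F := fun y0 y1 y2 => tlift (fun e c =>
    (B (c * y1) (x1 * y2) : K) *: (e * s y0)) (r (f x0)))); [|lin..].
under eq_tlift => a b do rewrite tlift_exchange.
rewrite tlift_exchange; apply: eq_tlift => e c.
rewrite (ip_actr BP (f := fun y0 => e * s y0)); last lin.
by rewrite scalerAl.
Qed.

End ComoduleAlgebra.
End Averaging.

(** * Subspaces and tensors with first factor in a subspace *)

Section Subspace.
Variable K : fieldType.
Implicit Types V W X : lmodType K.

Definition subspace V (S : V -> Prop) : Prop :=
  S 0 /\ forall a x y, S x -> S y -> S (a *: x + y).

Lemma subspaceD V (S : V -> Prop) x y : subspace S -> S x -> S y -> S (x + y).
Proof. by case=> _ Slin Sx Sy; rewrite -[x]scale1r; apply: Slin. Qed.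

Lemma subspaceZ V (S : V -> Prop) a x : subspace S -> S x -> S (a *: x).
Proof. by case=> S0 Slin Sx; rewrite -[_ *: _]addr0; apply: Slin. Qed.

Lemma subspaceB V (S : V -> Prop) x y : subspace S -> S x -> S y -> S (x - y).
Proof.
by move=> SP Sx Sy; apply: subspaceD => //; rewrite -scaleN1r; apply: subspaceZ.
Qed.

Lemma subspace_tlift V W X (S : X -> Prop) (F : V -> W -> X) t : subspace S ->
  (forall v w, S (F v w)) -> S (tlift F t).
Proof.
move=> SP SF; rewrite /tlift; apply: (big_ind S) => //; first by case: SP.
by move=> x y; apply: subspaceD.
Qed.

(** For a subspace S this is the image of S ⊗ W in V ⊗ W; scalars are absorbed by the second
    factor. *)
Inductive tensor_in V W (S : V -> Prop) : V ⊗[K] W -> Prop :=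
| tensor_in0 : tensor_in S 0
| tensor_inD x y : tensor_in S x -> tensor_in S y -> tensor_in S (x + y)
| tensor_in_tens v w : S v -> tensor_in S (v ⊗ w).

Lemma tensor_in_tlift V W V' W' (S : V -> Prop) (F : V' -> W' -> V ⊗[K] W) t :
  (forall v w, tensor_in S (F v w)) -> tensor_in S (tlift F t).
Proof.
move=> SF; rewrite /tlift; apply: (big_ind (tensor_in S)) => //.
  exact: tensor_in0.
exact: tensor_inD.
Qed.

Lemma tlift_tensor_in V W X (S : V -> Prop) (T : X -> Prop) (F : V -> W -> X) t :
  (forall w, linear (fun v => F v w)) -> (forall v, linear (fun w => F v w)) ->
  subspace T -> (forall v w, S v -> T (F v w)) -> tensor_in S t -> T (tlift F t).
Proof.
move=> F1 F2 TP ST; elim=> {t} [|x y _ IHx _ IHy|v w Sv].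
- by rewrite lin0; [case: TP|lin].
- by rewrite linD; [apply: subspaceD|lin].
- by rewrite tliftE; [apply: ST|lin..].
Qed.

End Subspace.

Lemma tliftB (K : fieldType) (V W X : lmodType K) (F G : V -> W -> X) t :
  tlift F t - tlift G t = tlift (fun v w => F v w - G v w) t.
Proof. by rewrite /tlift sumrB. Qed.

(** * Powers of the kernel *)

Section KernelPowers.
Variables (K : fieldType) (E A : algType K) (p : {lrmorphism E -> A}).

(** The k-th power of the ideal ker p, the 0-th being E: sums of products of k kernel elements
    followed by an arbitrary element. *)
Inductive kpow : nat -> E -> Prop :=
| kpow_all x : kpow 0 x
| kpow0 k : kpow k 0
| kpowD k x y : kpow k x -> kpow k y -> kpow k (x + y)
| kpow_cons k a x : p a = 0 -> kpow k x -> kpow k.+1 (a * x).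

Lemma kpow_subspace k : subspace (kpow k).
Proof.
split=> [|a x y kx]; first exact: kpow0; apply: kpowD.
elim: kx => {k x y} [x|k|k x y _ kx _ ky|k b x pb _ kx].
- exact: kpow_all.
- by rewrite scaler0; apply: kpow0.
- by rewrite scalerDr; apply: kpowD.
- by rewrite scalerAr; apply: kpow_cons.
Qed.

Lemma kpow_mull k x y : kpow k x -> kpow k (y * x).
Proof.
elim=> {k x} [x|k|k x z _ kx _ kz|k b x pb kx _].
- exact: kpow_all.
- by rewrite mulr0; apply: kpow0.
- by rewrite mulrDr; apply: kpowD.
- by rewrite mulrA; apply: kpow_cons => //; rewrite rmorphM /= pb mulr0.
Qed.

Lemma kpow1 x : p x = 0 -> kpow 1 x.
Proof. by move=> px; rewrite -[x]mulr1; apply/kpow_cons/kpow_all. Qed.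

Lemma kpow_ker k x : kpow k.+1 x -> p x = 0.
Proof.
move: {1 3}k.+1 (erefl k.+1) => n en kx; elim: kx en => {n x} //.
- by move=> n _; rewrite raddf0.
- by move=> n x y _ IHx _ IHy en; rewrite raddfD /= IHx // IHy // addr0.
- by move=> n a x pa _ _ _; rewrite rmorphM /= pa mul0r.
Qed.

(** [kpow] adds kernel factors on the left. A kernel factor on the right counts too: it is absorbed
    by the arbitrary last element, which thereby enters the kernel. *)
Lemma kpow_mul_ker k x y : kpow k x -> p y = 0 -> kpow k.+1 (x * y).
Proof.
move=> kx py; elim: kx => {k x} [x|k|k x z _ kx _ kz|k b x pb _ kx].
- exact/kpow_mull/kpow1.
- by rewrite mul0r; apply: kpow0.
- by rewrite mulrDl; apply: kpowD.
- by rewrite -mulrA; apply: kpow_cons.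
Qed.

(** As k is positive, the second element lies in the kernel and contributes one more factor. This
    makes quadratic error terms negligible. *)
Lemma kpow_mul k x y : (0 < k)%N -> kpow k x -> kpow k y -> kpow k.+1 (x * y).
Proof. by case: k => // k _ kx /kpow_ker; apply: kpow_mul_ker. Qed.

Lemma kpow_nilpotent : nilpotent_kernel p ->
  exists n, forall k x, (n <= k)%N -> kpow k x -> x = 0.
Proof.
case=> n nilp; exists n => k x.
(* The list s collects the kernel factors already peeled off y. *)
suff gen k' y : kpow k' y -> forall s : seq E, (n <= size s + k')%N ->
    {in s, forall z, p z = 0} -> \prod_(z <- s) z * y = 0.
  by move=> nk kx; have := gen k x kx [::] nk; rewrite big_nil mul1r; apply.
elim=> {k' y k x} [x|k|k x y _ IHx _ IHy|k a x pa _ IHx] s ns ps.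
(* With nothing left to peel, s has at least n entries; nilpotency speaks of exactly n factors, so
   the first n are split off. *)
- rewrite -[s](cat_take_drop n) big_cat /=.
  suff -> : \prod_(z <- take n s) z = 0 by rewrite !mul0r.
  rewrite addn0 in ns.
  have st : size (take n s) = n by apply: size_takel.
  rewrite (big_nth 0) st big_mkord; apply: nilp => i; apply: ps.
  by apply/mem_take/mem_nth; rewrite st.
- by rewrite mulr0.
- by rewrite mulrDr IHx // IHy // addr0.
- rewrite mulrA -big_rcons /=; apply: IHx; first by rewrite size_rcons addSnnS.
  by move=> z; rewrite mem_rcons inE => /predU1P[-> //|]; apply: ps.
Qed.

End KernelPowers.

(** * Averaging modulo powers of the kernel *)

Definition curvature (A E : pzRingType) (t : A -> E) (x y : A) : E :=
  t (x * y) - t x * t y.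

(* Q stands for colinearity and Av for the corresponding averaging operator; the
   last condition says that averaging spoils neither the proximity of t to the
   Q-section s nor the multiplicativity of t to one order more. *)
Definition smoothing (K : fieldType) (E A : algType K) (p : {lrmorphism E -> A})
    (Q : (A -> E) -> Prop) (Av : (A -> E) -> A -> E) : Prop :=
  forall t, linear t ->
  [/\ linear (Av t), Q (Av t), cancel t p -> cancel (Av t) p, t 1 = 1 -> Av t 1 = 1
    & forall k s, (0 < k)%N -> linear s -> Q s ->
      (forall x, kpow p k (t x - s x)) ->
      (forall x y, kpow p k.+1 (curvature t x y)) ->
      (forall x, kpow p k (Av t x - s x)) /\
      (forall x y, kpow p k.+1 (curvature (Av t) x y))].

Section AverageSmoothing.
Variables (K : fieldType) (H : algType K).
Variables (delta : {linear H -> H ⊗[K] H}) (B : H -> H -> K^o).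
Hypothesis BP : invariant_pairing delta B.
Let Bl := ip_linl BP.
Let Br := ip_linr BP.
#[local] Hint Resolve Bl Br : core.
Variables (E : algType K) (r : {linear E -> E ⊗[K] H}).
Hypothesis r_coassoc : forall (X : lmodType K) (F : E -> H -> H -> X) e,
    (forall b c, linear (fun a => F a b c)) ->
    (forall a c, linear (fun b => F a b c)) ->
    (forall a b, linear (fun c => F a b c)) ->
    tlift (fun a b => tlift (fun a1 a2 => F a1 a2 b) (r a)) (r e) =
    tlift (fun a b => tlift (fun b1 b2 => F a b1 b2) (delta b)) (r e).
Hypothesis rM : forall (X : lmodType K) (F : E -> H -> X) x y,
  (forall b, linear (fun a => F a b)) -> (forall a, linear (fun b => F a b)) ->
  tlift F (r (x * y)) =
  tlift (fun a b => tlift (fun a' b' => F (a * a') (b * b')) (r y)) (r x).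
Hypothesis r1 : r 1 = 1 ⊗ 1.
Variable p : {lrmorphism E -> H}.
Hypothesis pr : forall e, delta (p e) = tmap p id (r e).
Hypothesis p_surj : forall h, exists e, p e = h.

Let p_lin : linear p.
Proof. exact: linearP. Qed.
#[local] Hint Resolve p_lin : core.

(** The coaction of a is killed by p ⊗ id, because p is colinear. Subtracting s(p(e)) ⊗ h, for a
    linear section s, then leaves it unchanged and moves its first factors into ker p. *)
Lemma coaction_ker a : p a = 0 -> tensor_in (fun e => p e = 0) (r a).
Proof.
move=> pa; have [s sl sK] := linear_section p_surj.
have -> : r a = tlift (fun e h => (e - s (p e)) ⊗ h) (r a).
  have s0 : tlift (fun e h => s (p e) ⊗ h) (r a) = 0.
    rewrite -(tlift_tmap (F := fun h h' => s h ⊗ h') (f := p) (g := id)); [|lin..].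
    by rewrite -pr pa linear0 lin0; last lin.
  rewrite -[LHS]subr0 -s0 -{1}[r a]tlift_id tliftB; apply: eq_tlift => e h.
  by rewrite (linB (f := fun z => z ⊗ h)); last lin.
apply: tensor_in_tlift => e h; apply: tensor_in_tens.
by rewrite raddfB /= sK subrr.
Qed.

(** The coaction is multiplicative, so the case of one kernel factor propagates to all powers;
    averaging therefore respects them. *)
Lemma coaction_kpow k x : kpow p k x -> tensor_in (kpow p k) (r x).
Proof.
elim=> {k x} [x|k|k x y _ kx _ ky|k a x pa _ kx].
- rewrite -[r x]tlift_id; apply: tensor_in_tlift => e h.
  exact/tensor_in_tens/kpow_all.
- by rewrite linear0; apply: tensor_in0.
- by rewrite linearD; apply: tensor_inD.
rewrite -[r _]tlift_id rM; [|lin..].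
elim: (coaction_ker pa) => [|t u _ IHt _ IHu|e h pe].
- by rewrite lin0; [apply: tensor_in0|lin].
- by rewrite linD; [apply: tensor_inD|lin].
rewrite tliftE; [|lin..].
elim: kx => [|t u _ IHt _ IHu|e' h' ke'].
- by rewrite lin0; [apply: tensor_in0|lin].
- by rewrite linD; [apply: tensor_inD|lin].
by rewrite tliftE; [apply/tensor_in_tens/kpow_cons|lin..].
Qed.

Lemma slice_kpow k h x : kpow p k x -> kpow p k (slice B h (r x)).
Proof.
move=> /coaction_kpow kx; have kP := kpow_subspace p k.
apply: tlift_tensor_in kx => //; [lin..|move=> e h' ke].
exact: subspaceZ.
Qed.

Let slice_lin h : linear (slice B h : E ⊗[K] H -> E).
Proof. exact: (slice_linear BP). Qed.
Let slice_linl (t : E ⊗[K] H) : linear (fun h => slice B h t).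
Proof. exact: (slice_linearl BP). Qed.
#[local] Hint Resolve slice_lin slice_linl : core.

Definition colinear (f : H -> E) : Prop := forall h, r (f h) = tmap f id (delta h).

(** The law [ip_diag] at 1 reads B(1, 1) 1 = 1 in H, where 1 is not zero. *)
Lemma pairing11 : B 1 1 = 1.
Proof.
have /= := ip_diag BP 1 (@lin_id K H).
rewrite (ip_comul1 BP) tliftE; [|lin..].
rewrite (ip_comul1 BP) tliftE; [|lin..].
move/eqP; rewrite -subr_eq0 -[X in _ - X]scale1r -scalerBl scaler_eq0 oner_eq0.
by rewrite orbF subr_eq0 => /eqP.
Qed.

(** Adding (t x - s x)(t y - s y) to the curvature cancels the term t x t y, quadratic in t, and
    leaves t(xy) - s x t y - t x s y + s x s y. Averaging is compatible with each of these terms, as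
    s is colinear. *)
Lemma average2_curvature s t x y :
  linear s -> colinear s -> linear t ->
  average2 delta B r (fun x y => curvature t x y + (t x - s x) * (t y - s y)) x y =
  curvature (average delta B r t) x y +
  (average delta B r t x - s x) * (average delta B r t y - s y).
Proof.
move=> sl sr tl.
have expand (u : H -> E) a b : curvature u a b + (u a - s a) * (u b - s b) =
    (u (a * b) - s a * u b) - (u a * s b - s a * s b).
  rewrite /curvature mulrBl !mulrBr !opprB -!addrA; congr (_ + _).
  by rewrite addKr addrCA [RHS]addrCA [- _ - _]addrC.
rewrite expand -(average2_mul BP r x y tl) -(average2_mull BP rM sl sr x y tl).
(* In s x s y the factor s y is written as its own average, so that this term has the same shape as
   the others. *)
rewrite -(average2_mulr BP rM sl sr x y tl) -[s y in X in _ - (_ - X)](average_fix BP sl sr).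
rewrite -(average2_mull BP rM sl sr x y sl) /average2 !tliftB.
apply: eq_tlift => x0 x1; rewrite !tliftB; apply: eq_tlift => y0 y1.
by rewrite expand !(linearB r) /= !(linB _ _ (slice_lin _)).
Qed.

Lemma average_smoothing : smoothing p colinear (average delta B r).
Proof.
move=> t tl; have atl : linear (average delta B r t) by apply: average_linear.
split=> //.
- exact: average_colinear.
(* Composed with p, the average of t becomes the average of the identity of H, which is colinear and
   hence fixed. *)
- move=> tK h; rewrite (average_map BP (rW := delta)) //.
  have -> : (fun h => p (t h)) = id by apply: funext.
  apply: (average_fix BP (f := id)) => // h'.
  by rewrite -{1}[delta h']tlift_id.
- move=> t1; rewrite /average (ip_comul1 BP) tliftE; [|lin..].
  rewrite t1 r1 /slice tliftE; [|lin..].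
  by rewrite pairing11 scale1r.
move=> k s k0 sl sr ts tc; have kP := kpow_subspace p.
have ats x : kpow p k (average delta B r t x - s x).
  (* As s is its own average, the difference is the average of t - s. *)
  rewrite -[s x](average_fix BP sl sr) /average tliftB.
  apply: subspace_tlift => // h0 h1; rewrite -linB // -linearB.
  exact: slice_kpow.
(* The curvature of the average is the average of an element of the power k + 1, minus a product of
   two elements of the power k. *)
split=> // x y; rewrite -[curvature _ _ _](addrK
  ((average delta B r t x - s x) * (average delta B r t y - s y))).
apply: subspaceB => //; last exact: kpow_mul.
rewrite -average2_curvature //; do 2!apply: subspace_tlift => // ? ?.
apply: slice_kpow; apply: subspaceD => //; exact: kpow_mul.
Qed.
End AverageSmoothing.

(** * Correction of the curvature *)

Section RightFree.
Variables (K : fieldType) (A : algType K) (P : bimodule A).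
Let ll a : linear (fun x : P => lact a x). Proof. exact: (lact_bilinear P).2. Qed.
Let ll' (x : P) : linear (fun a : A => lact a x). Proof. exact: (lact_bilinear P).1. Qed.
Let rl (x : P) : linear (fun a : A => ract x a). Proof. exact: (ract_bilinear P).2. Qed.
Let rl' a : linear (fun x : P => ract x a). Proof. exact: (ract_bilinear P).1. Qed.
#[local] Hint Resolve ll ll' rl rl' : core.

Definition rfree_lact (a : A) (t : P ⊗[K] A) := tlift (fun x b => lact a x ⊗ b) t.
Definition rfree_ract (t : P ⊗[K] A) (a : A) := tlift (fun x b => x ⊗ (b * a)) t.

Lemma rfree_lact_bilinear : bilinear_for *:%R *:%R rfree_lact.
Proof. by rewrite /rfree_lact; split; lin. Qed.

Lemma rfree_ract_bilinear : bilinear_for *:%R *:%R rfree_ract.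
Proof. by rewrite /rfree_ract; split; lin. Qed.

Lemma rfree_lact1 t : rfree_lact 1 t = t.
Proof. by rewrite -[RHS]tlift_id; apply: eq_tlift => x b; rewrite lact1. Qed.

Lemma rfree_ract1 t : rfree_ract t 1 = t.
Proof. by rewrite -[RHS]tlift_id; apply: eq_tlift => x b; rewrite mulr1. Qed.

Lemma rfree_lactM a b t : rfree_lact (a * b) t = rfree_lact a (rfree_lact b t).
Proof.
rewrite /rfree_lact [RHS]map_tlift; last lin.
by apply: eq_tlift => x c; rewrite tliftE ?lactM; [|lin..].
Qed.

Lemma rfree_ractM a b t : rfree_ract t (a * b) = rfree_ract (rfree_ract t a) b.
Proof.
rewrite /rfree_ract [RHS]map_tlift; last lin.
by apply: eq_tlift => x c; rewrite tliftE ?mulrA; [|lin..].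
Qed.

Lemma rfree_lractA a b t :
  rfree_ract (rfree_lact a t) b = rfree_lact a (rfree_ract t b).
Proof.
rewrite /rfree_ract /rfree_lact !map_tlift; [|lin..].
by apply: eq_tlift => x c; rewrite !tliftE; [|lin..].
Qed.

Lemma rfree_lact_tens a x b : rfree_lact a (x ⊗ b) = lact a x ⊗ b.
Proof. by rewrite /rfree_lact tliftE; [|lin..]. Qed.

Lemma rfree_ract_tens a x b : rfree_ract (x ⊗ b) a = x ⊗ (b * a).
Proof. by rewrite /rfree_ract tliftE; [|lin..]. Qed.

(** The right action of P is forgotten and replaced by the free one on P ⊗ A; the old action becomes
    a bimodule map onto P. *)
Definition rfree : bimodule A :=
  Bimodule rfree_lact_bilinear rfree_ract_bilinear rfree_lact1 rfree_ract1
    rfree_lactM rfree_ractM rfree_lractA.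

Definition rfree_act : {linear rfree -> P} :=
  linear_pack (tlift_is_linear (ract_bilinear P)).

Lemma rfree_act_tens x a : rfree_act (x ⊗ a) = ract x a.
Proof. by rewrite /= tliftE. Qed.

Lemma rfree_act_morph : bimod_morph rfree_act.
Proof.
split=> a t /=; rewrite /rfree_lact /rfree_ract.
  rewrite [LHS]map_tlift; last lin; rewrite [RHS]map_tlift; last lin.
  by apply: eq_tlift => x b; rewrite tliftE ?lractA; [|lin..].
rewrite [LHS]map_tlift; last lin.
rewrite [RHS](map_tlift (f := fun x => ract x a)); last lin.
by apply: eq_tlift => x b; rewrite tliftE ?ractM; [|lin..].
Qed.

(** The action map is split linearly by x ↦ x ⊗ 1, so relative projectivity lifts the identity of
    P. *)
Lemma rel_projective_rfree : rel_projective P ->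
  exists2 h : {linear P -> rfree}, bimod_morph h & cancel h rfree_act.
Proof.
move=> Pproj; apply: (Pproj _ _ rfree_act rfree_act_morph _ idfun) => //.
exists (linear_pack (lin_tensl (1 : A) (@lin_id _ P))) => x.
by rewrite rfree_act_tens ract1.
Qed.

End RightFree.

(** * The universal derivation and the correcting cochain *)

Section UniversalDerivation.
Variables (K : fieldType) (A : algType K).

Lemma univ_der_subproof (a : A) : (1 ⊗ a - a ⊗ 1 : A ⊗[K] A) \in @in_Omega1 K A.
Proof. by rewrite unfold_in linearB /= !mult_tens mul1r mulr1 subrr. Qed.

Definition univ_der (a : A) : Omega1_bimodule A := MkOmega1 (univ_der_subproof a).

Lemma univ_der_linear : linear univ_der.
Proof.
move=> k a b; apply: val_inj; rewrite [RHS]linearP /=.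
rewrite tensDl tensDr tensZl tensZr scalerBr opprD addrACA; congr (_ + _).
Qed.

Lemma univ_derM a b : univ_der (a * b) = lact a (univ_der b) + ract (univ_der a) b.
Proof.
apply: val_inj; rewrite [RHS]raddfD /= linB; last exact: outer_lact_linear.
rewrite (linB _ _ (@outer_ract_linear K A b)) !outer_lact_tens !outer_ract_tens.
by rewrite !mulr1 !mul1r [RHS]addrC addrA subrK.
Qed.
End UniversalDerivation.

Section Correction.
Variables (K : fieldType) (A E : algType K) (p : {lrmorphism E -> A}).
Variables (s : A -> E) (k : nat).
Hypotheses (k_gt0 : (0 < k)%N) (sl : linear s) (sK : cancel s p) (s1 : s 1 = 1).
Hypothesis s_curv : forall a b, kpow p k (curvature s a b).

Let c := curvature s.
Let cl b : linear (fun a => c a b). Proof. by rewrite /c /curvature; lin. Qed.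
Let cr a : linear (fun b => c a b). Proof. by rewrite /c /curvature; lin. Qed.
#[local] Hint Resolve cl cr : core.

Let kP := kpow_subspace p.

Let Omega := Omega1_bimodule A.
Let val_lin : linear (val : Omega -> A ⊗[K] A).
Proof. exact: linearP. Qed.
#[local] Hint Resolve val_lin : core.

(** Since c(1, y) = 0, the element x dv = x ⊗ v - xv ⊗ 1 is sent to s(x) c(v, y): the map out of Ω¹
    attached to the cocycle c, with y as a parameter. *)
Let T0 (w : Omega) (y : A) : E := tlift (fun x v => s x * c v y) (val w).
Let T0l y : linear (fun w => T0 w y).
Proof. rewrite /T0. apply: lin_tlift_arg; lin. Qed.
Let T0r w : linear (fun y => T0 w y). Proof. by rewrite /T0; lin. Qed.
#[local] Hint Resolve T0l T0r : core.

Let T (m : rfree Omega) : E := tlift T0 m.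
Let Tl : linear T. Proof. by rewrite /T; lin. Qed.

Let cc_kpow a b a' b' : kpow p k.+1 (c a b * c a' b').
Proof. exact: kpow_mul. Qed.

(** The error is a sum of terms (s(ax) - s(a) s(x)) c(v, y) = c(a, x) c(v, y), products of two
    curvatures. *)
Let T_lact a m : kpow p k.+1 (T (lact a m) - s a * T m).
Proof.
rewrite /T map_tlift; last lin; rewrite map_tlift; last lin.
rewrite tliftB; apply: subspace_tlift => // w y.
rewrite tliftE; [|lin..].
rewrite /T0 /= /outer_lact tlift_tmap; [|lin..].
rewrite map_tlift; last lin.
rewrite tliftB; apply: subspace_tlift => // x v.
rewrite mulrA -mulrBl; exact: (cc_kpow a x v y).
Qed.

(** The Hochschild cocycle identity, with s in place of the actions of A; in this form it holds
    exactly, by associativity. *)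
Let cocycle x y z : c x (y * z) - c x y * s z = c (x * y) z - s x * c y z.
Proof.
rewrite /c /curvature mulrBl mulrBr !mulrA !opprB -!addrA; congr (_ + _).
by rewrite addrCA [RHS]addrCA [- _ - _]addrC.
Qed.

(** By the cocycle identity the error is the sum of s(x) c(vy, z) - s(xv) c(y, z) + c(x, v) c(y, z).
    The first two sums vanish and the last is negligible. *)
Let T_ract m z : rfree_act Omega m = 0 -> kpow p k.+1 (T (ract m z) - T m * s z).
Proof.
move=> gm0.
suff -> : T (ract m z) - T m * s z =
    tlift (fun w y => tlift (fun x v => c x v * c y z) (val w)) m.
  by do 2!apply: subspace_tlift => // ? ?.
(* This sum depends only on the image of m under the action map, which is zero. *)
have E1 : tlift (fun w y => tlift (fun x v => s x * c (v * y) z) (val w)) m = 0.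
  transitivity (tlift (fun x v => s x * c v z) (val (rfree_act Omega m))).
    rewrite [RHS](map_tlift (f := fun w : Omega => tlift (fun x v => s x * c v z) (val w))).
      apply: eq_tlift => w y; rewrite /= /outer_ract tlift_tmap //; lin.
    apply: lin_tlift_arg; lin.
  by rewrite gm0 /= lin0; last lin.
(* Elements of Ω¹ are killed by the multiplication, so the sum of the s(xv) is zero. *)
have E2 : tlift (fun (w : Omega) y => tlift (fun x v => s (x * v) * c y z) (val w)) m = 0.
  rewrite /tlift big1 // => -[w y] _; rewrite -/(tlift _ _) /=.
  transitivity (s (mult (val w)) * c y z).
    rewrite /mult map_tlift // [RHS](map_tlift (f := fun e => e * c y z)) //; lin.
  by rewrite (eqP (valP w : mult _ == 0)) lin0 // mul0r.
rewrite -[RHS]opprK -[X in _ = X]sub0r -[X in _ = X - _]E1 -[X in _ = _ - X]sub0r.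
rewrite -[X in _ = _ - (X - _)]E2 !tliftB /T map_tlift; last lin.
rewrite (map_tlift (f := fun e => e * s z)); last lin.
rewrite tliftB; apply: eq_tlift => w y; rewrite tliftE; [|lin..].
rewrite /T0 (map_tlift (f := fun e => e * s z)); last lin.
rewrite !tliftB; apply: eq_tlift => x v.
rewrite -mulrA -mulrBr cocycle mulrBr -mulrBl mulrA; congr (_ - _ * _).
by rewrite /c /curvature opprB addrC subrK.
Qed.

Variable h : {linear Omega -> rfree Omega}.
Hypotheses (hM : bimod_morph h) (hK : cancel h (rfree_act Omega)).

(* The correction is T (defect a), where T ((x ⊗ v) ⊗ y) = s(x) c(v, y).  Modulo
   the k.+1-st power of ker p, T is left linear, and it is right linear on the
   kernel of the action, where defect takes its values. *)
Let defect (a : A) : rfree Omega := univ_der a ⊗ 1 - h (univ_der a).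

Let defect_lin : linear defect.
Proof.
have dl := @univ_der_linear K A.
rewrite /defect; apply: lin_add; first by apply: lin_tensl.
by apply: lin_opp; apply: lin_comp => //; apply: linearP.
Qed.

Let defect_act a : rfree_act Omega (defect a) = 0.
Proof. by rewrite linearB hK rfree_act_tens ract1 subrr. Qed.

(** By the Leibniz rule and the bimodule linearity of [h], all terms containing [h] cancel. *)
Let defectM a b : lact a (defect b) + ract (defect a) b - defect (a * b) =
  univ_der a ⊗ b - ract (univ_der a) b ⊗ 1.
Proof.
have actl := (lact_bilinear (rfree Omega)).2 a; have actr := (ract_bilinear (rfree Omega)).1 b.
rewrite /defect (linB _ _ actl) (linB _ _ actr) -hM.1 -hM.2 /=.
rewrite rfree_lact_tens rfree_ract_tens mul1r univ_derM (linearD h) tensDl.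
have cancelE (V : zmodType) (x y z u v : V) :
    x - u + (z - v) - (x + y - (u + v)) = z - y.
  by rewrite addrACA -opprD opprB addrA subrK opprD addrACA subrr add0r.
exact: cancelE.
Qed.

Lemma curvature_correction : exists t : A -> E,
  [/\ linear t, cancel t p, t 1 = 1, forall a, kpow p k (t a - s a)
    & forall a b, kpow p k.+1 (curvature t a b)].
Proof.
exists (fun a => s a + T (defect a)).
have Tk m : kpow p k (T m).
  by do 2!apply: subspace_tlift => // ? ?; apply: kpow_mull.
have d1 : defect 1 = 0.
  rewrite /defect; have -> : univ_der 1 = 0 :> Omega by apply: val_inj; rewrite /= subrr.
  by rewrite (linear0 h) subr0 (lin0 (f := fun z => z ⊗ 1)); last lin.
split.
- by apply: lin_add => //; apply: lin_comp.
- move=> a; rewrite raddfD /= sK; case: (k) (k_gt0) (Tk (defect a)) => // n _.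
  by move/kpow_ker=> /= ->; rewrite addr0.
- by rewrite s1 d1 lin0 // addr0.
- by move=> a; rewrite [s a + _]addrC addrK.
move=> a b.
(* The value is s(1) c(a, b) - s(a) c(1, b), where s(1) = 1 and c(1, b) = 0. *)
have T1 : T (univ_der a ⊗ b) = c a b.
  rewrite /T tliftE // /T0 /= linB; last lin.
  by rewrite !tliftE; [|lin..]; rewrite s1 mul1r {2}/c /curvature s1 !mul1r subrr mulr0 subr0.
(* Every term contains a factor c(v, 1), which is zero. *)
have T2 : T (ract (univ_der a) b ⊗ 1) = 0.
  rewrite /T tliftE // /T0 /tlift big1 // => q _.
  by rewrite /c /curvature s1 !mulr1 subrr mulr0.
have Tab : c a b = T (lact a (defect b)) + T (ract (defect a) b) - T (defect (a * b)).
  by rewrite -linD // -linB // defectM linB // T1 T2 subr0.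
(* What remains are the failures of left and right linearity of [T] and a term quadratic in the
   correction, all in the power k + 1. *)
have -> : curvature (fun a => s a + T (defect a)) a b =
    (T (lact a (defect b)) - s a * T (defect b)) +
    (T (ract (defect a) b) - T (defect a) * s b) - T (defect a) * T (defect b).
  have -> : curvature (fun a => s a + T (defect a)) a b =
      c a b + T (defect (a * b)) - s a * T (defect b) - (T (defect a) * s b)
        - T (defect a) * T (defect b).
    rewrite /c /curvature mulrDl !mulrDr !opprD !addrA; congr (_ - _ - _ - _).
    by rewrite addrAC.
  by rewrite Tab subrK -!addrA; congr (_ + _); rewrite addrCA.
apply: subspaceB => //; last exact: kpow_mul.
apply: subspaceD => //; exact: T_ract (defect_act a).
Qed.
End Correction.

(** * Lifting *)

(** The estimates produced by the first averaging are the hypotheses of the second, which in turn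
    must not destroy the property gained by the first. *)
Lemma smoothing_comp (K : fieldType) (E A : algType K) (p : {lrmorphism E -> A})
    (Q1 Q2 : (A -> E) -> Prop) (Av1 Av2 : (A -> E) -> A -> E) :
  smoothing p Q1 Av1 -> smoothing p Q2 Av2 ->
  (forall f, linear f -> Q1 f -> Q1 (Av2 f)) ->
  smoothing p (fun f => Q2 f /\ Q1 f) (fun f => Av2 (Av1 f)).
Proof.
move=> sm1 sm2 Q12 t tl; have [l1 q1 K1 u1 c1] := sm1 t tl.
have [l2 q2 K2 u2 c2] := sm2 _ l1; split=> // [|/K1|/u1|]; auto.
by move=> k s k0 sl [Qs2 Qs1] ts tc; have [] := c1 k s k0 sl Qs1 ts tc; auto.
Qed.

Lemma smoothing_section (K : fieldType) (E A : algType K) (p : {lrmorphism E -> A})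
    (Q : (A -> E) -> Prop) (Av : (A -> E) -> A -> E) (eps : {scalar A}) :
  eps 1 = 1 -> formally_smooth A -> (forall a, exists e, p e = a) ->
  nilpotent_kernel p -> smoothing p Q Av ->
  exists s : {lrmorphism A -> E}, Q s /\ cancel s p.
Proof.
move=> eps1 smA p_surj nilp AvP.
have [h hM hK] := rel_projective_rfree smA.
have lift k : exists s, [/\ linear s, Q s, cancel s p, s 1 = 1
    & forall a b, kpow p k.+1 (curvature s a b)].
  elim: k => [|k [s [sl sQ sK s1 sc]]].
    have [s0 s0l s0K] := linear_section p_surj.
    (* The added term makes the section unital; p kills 1 - s0(1), so it remains a section. *)
    pose s a := s0 a + eps a *: (1 - s0 1).
    have sl : linear s by rewrite /s; lin.
    have sK : cancel s p.
      by move=> a; rewrite /s raddfD /= linearZ_LR raddfB /= rmorph1 !s0K subrr scaler0 addr0.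
    have s1 : s 1 = 1 by rewrite /s eps1 scale1r addrC subrK.
    have [l1 q1 K1 u1 _] := AvP s sl.
    exists (Av s); split=> //; [exact: K1|exact: u1|move=> a b; apply: kpow1].
    by rewrite /curvature raddfB /= rmorphM /= !K1 // subrr.
  have [t [tl tK t1 ts tc]] := curvature_correction (ltn0Sn k) sl sK s1 sc hM hK.
  have [l1 q1 K1 u1 c1] := AvP t tl.
  have [_ cc] := c1 _ _ (ltn0Sn k) sl sQ ts tc.
  by exists (Av t); split=> //; [exact: K1|exact: u1].
have [n kn] := kpow_nilpotent nilp.
(* The curvature now lies in the power n + 1 of the kernel, which is zero. *)
have [s [sl sQ sK s1 sc]] := lift n.
have sM : monoid_morphism s.
  by split=> // a b; apply/eqP; rewrite -subr_eq0; apply/eqP; exact: kn (leqnSn n) (sc a b).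
pose L := GRing.isLinear.Build _ _ _ _ s sl.
pose M := GRing.isMonoidMorphism.Build _ _ s sM.
pose s' : {lrmorphism A -> E} := HB.pack s L M.
by exists s'.
Qed.

Lemma tlift_tinterchange (K : fieldType) (V1 V2 V3 V4 X : lmodType K)
    (F : V1 ⊗[K] V3 -> V2 ⊗[K] V4 -> X) x y :
  (forall b, linear (fun a => F a b)) -> (forall a, linear (fun b => F a b)) ->
  tlift F (tinterchange (x ⊗ y)) =
  tlift (fun v1 v2 => tlift (fun v3 v4 => F (v1 ⊗ v3) (v2 ⊗ v4)) y) x.
Proof.
move=> F1 F2; rewrite /tinterchange tliftE; [|lin..].
rewrite map_tlift; last lin; apply: eq_tlift => v1 v2.
by rewrite map_tlift; last lin; apply: eq_tlift => v3 v4; rewrite tliftE; [|lin..].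
Qed.

Lemma tflip_tmap (K : fieldType) (V V' W W' : lmodType K) (f : V -> V') (g : W -> W')
    t : linear f -> linear g -> tflip (tmap f g t) = tmap g f (tflip t).
Proof.
move=> fl gl; rewrite /tflip tlift_tmap; [|lin..].
by rewrite /tmap tlift_tflip; [|lin..].
Qed.

(** * Right comodules *)

Section RightComodule.
Variables (K : fieldType) (H : hopfAlgType K) (lambda : {scalar H}).
Hypothesis lambdaP : ad_invariant_integral lambda.
Variables (E : algType K) (r : {linear E -> E ⊗[K] H}) (p : {lrmorphism E -> H}).
Hypotheses (rP : rcomodule r) (rM : rcolinear (rcodiag r r) r mult).
Hypotheses (r1 : rcolinear (@rtriv K H) r (fun k : K^o => k *: 1)).
Hypotheses (pr : rcolinear r comul p) (p_surj : forall h, exists e, p e = h).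

Lemma rcomodule_smoothing :
  smoothing p (rcolinear comul r) (average comul (integral_pairing lambda) r).
Proof.
apply: (average_smoothing (comul_invariant_pairing lambdaP)) => //.
- move=> X F e F1 F2 F3.
  have := congr1 (tlift (fun a => tlift (F a))) (rP.1 e).
  rewrite tlift_tassoc; [|lin..].
  rewrite tlift_tmap; [|lin..].
  by rewrite tlift_tmap; [|lin..].
- move=> X F x y F1 F2; rewrite -mult_tens rM /rcodiag.
  rewrite tlift_tmap; [|lin..].
  rewrite tlift_tmap; [|lin..].
  rewrite tmap_tens; [|exact: linearP..].
  rewrite tlift_tinterchange; [|lin..].
  by do 2!apply: eq_tlift => ? ?; rewrite !mult_tens.
- rewrite -{1}[1]scale1r (r1 1) /rtriv tmap_tens ?scale1r //.
  by move=> k a b; rewrite scalerDl scalerA.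
Qed.

End RightComodule.

(** * Left comodules, by flipping the tensor factors *)

Section LeftComodule.
Variables (K : fieldType) (H : hopfAlgType K) (lambda : {scalar H}).
Hypothesis lambdaP : ad_invariant_integral lambda.
Variables (E : algType K) (l : {linear E -> H ⊗[K] E}) (p : {lrmorphism E -> H}).
Hypotheses (lP : lcomodule l) (lM : lcolinear (lcodiag l l) l mult).
Hypotheses (l1 : lcolinear (@ltriv K H) l (fun k : K^o => k *: 1)).
Hypotheses (pl : lcolinear l comul p) (p_surj : forall h, exists e, p e = h).

Definition flip_coaction : {linear E -> E ⊗[K] H} :=
  linear_pack (lin_comp (@tflip_linear K H E) (linearP l)).

Lemma tlift_flip_coaction (X : lmodType K) (F : E -> H -> X) x :
  (forall b, linear (fun a => F a b)) -> (forall a, linear (fun b => F a b)) ->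
  tlift F (flip_coaction x) = tlift (fun h e => F e h) (l x).
Proof. exact: tlift_tflip. Qed.

(** Unfolded, this is B(h1, f(h2)_{-1}) f(h2)_0. *)
Definition left_average (f : H -> E) : H -> E :=
  average (coop_comul H) (fun x y => integral_pairing lambda y x) flip_coaction f.

Lemma lcolinearE (f : H -> E) : linear f ->
  lcolinear comul l f <-> colinear (coop_comul H) flip_coaction f.
Proof.
move=> fl; split=> fP h; first by rewrite /= fP tflip_tmap.
by apply: (can_inj (@tflipK K H E)); rewrite tflip_tmap //; apply: fP.
Qed.

Lemma lcomodule_smoothing : smoothing p (lcolinear comul l) left_average.
Proof.
have smP : smoothing p (colinear (coop_comul H) flip_coaction) left_average.
  apply: (average_smoothing (coop_invariant_pairing lambdaP)) => //.
  - move=> X F e F1 F2 F3; rewrite !tlift_flip_coaction; [|lin..].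
    under eq_tlift => h a do (rewrite tlift_flip_coaction; [|lin..]).
    under [RHS]eq_tlift => h a do (rewrite tlift_coop; [|lin..]).
    have := congr1 (tlift (fun h => tlift (fun h' a => F a h' h))) (lP.1 e).
    rewrite (tlift_tassoc (F := fun h h' a => F a h' h)); [|lin..].
    rewrite tlift_tmap; [|lin..].
    by rewrite tlift_tmap; [|lin..].
  - move=> X F x y F1 F2; rewrite tlift_flip_coaction; [|lin..].
    rewrite -mult_tens lM /lcodiag.
    rewrite tlift_tmap; [|lin..].
    rewrite tlift_tmap; [|lin..].
    rewrite tmap_tens; [|exact: linearP..].
    rewrite tlift_tinterchange; [|lin..].
    rewrite tlift_flip_coaction; [|lin..]; apply: eq_tlift => h a.
    rewrite tlift_flip_coaction; [|lin..]; apply: eq_tlift => h' a'.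
    by rewrite !mult_tens.
  - rewrite -{1}[1]scale1r /= (l1 1) /ltriv tflip_tmap //; last first.
      by move=> k a b; rewrite scalerDl scalerA.
    rewrite /tflip tliftE; [|lin..].
    rewrite tmap_tens ?scale1r //.
    by move=> k a b; rewrite scalerDl scalerA.
  - by move=> e; rewrite /= pl tflip_tmap //; apply: linearP.
move=> t tl; have [al aQ aK a1 ac] := smP t tl.
split=> //; first by apply/lcolinearE.
by move=> k s k0 sl /(lcolinearE sl); apply: ac.
Qed.

End LeftComodule.

(** The left average contracts only the left coaction, through which the right one passes since the
    two commute. Right colinearity of f and coassociativity of H do the rest. *)
Lemma left_average_rcolinear (K : fieldType) (H : hopfAlgType K) (lambda : {scalar H})
    (E : algType K) (l : {linear E -> H ⊗[K] E}) (r : {linear E -> E ⊗[K] H}) f :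
  (forall e, tassoc (tmap l id (r e)) = tmap id r (l e)) ->
  linear f -> rcolinear comul r f -> rcolinear comul r (left_average lambda l f).
Proof.
move=> lr fl fr h; pose B := integral_pairing lambda.
have Bl := @integral_pairing_linl K H lambda.
have Br := @integral_pairing_linr K H lambda.
pose phi x t := tlift (fun c e => (B x c : K) *: e) (l t).
have phi1 x : linear (phi x) by rewrite /phi /B; lin.
have phi2 t : linear (fun x => phi x t) by rewrite /phi /B; lin.
have avE x : left_average lambda l f x = tlift (fun x1 x0 => phi x1 (f x0)) (comul x).
  rewrite /left_average /average tlift_coop.
  - by apply: eq_tlift => x1 x0; rewrite /slice tlift_flip_coaction; [|lin..].
  - move=> b; rewrite /slice; lin.
  - move=> a; rewrite /slice; lin.
have r_phi x t : r (phi x t) = tlift (fun e d => phi x e ⊗ d) (r t).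
  have := congr1 (tlift (fun c => tlift (fun e d => (B x c : K) *: (e ⊗ d)))) (lr t).
  rewrite (tlift_tassoc (F := fun c e d => (B x c : K) *: (e ⊗ d))); [|rewrite /B; lin..].
  rewrite tlift_tmap; [|rewrite /B; lin..].
  rewrite tlift_tmap; [|rewrite /B; lin..].
  move=> E1; rewrite /phi map_tlift; last lin.
  transitivity (tlift (fun c e => tlift (fun e' d => (B x c : K) *: (e' ⊗ d)) (r e)) (l t)).
    apply: eq_tlift => c e; rewrite linearZ_LR -{1}[r e]tlift_id.
    by rewrite (map_tlift (f := fun z => (B x c : K) *: z)); last lin.
  rewrite -E1; apply: eq_tlift => e d.
  rewrite (map_tlift (f := fun z => z ⊗ d)); last lin.
  by apply: eq_tlift => c e'; rewrite tensZl.
rewrite avE map_tlift; last lin.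
transitivity (tlift (fun x1 x2 => tlift (fun x21 x22 => phi x1 (f x21) ⊗ x22) (comul x2))
  (comul h)).
  apply: eq_tlift => x1 x2; rewrite r_phi fr tlift_tmap; [|lin..].
  by [].
rewrite -(coassoc_tlift (F := fun x1 x21 x22 => phi x1 (f x21) ⊗ x22)); [|lin..].
rewrite /tmap; apply: eq_tlift => x1 x2; rewrite avE.
by rewrite (map_tlift (f := fun z => z ⊗ x2)); last lin.
Qed.

Theorem theorem4p8 (K : fieldType) (H : hopfAlgType K)
    (H_integral : exists lambda : {scalar H}, ad_invariant_integral lambda)
    (H_smooth : formally_smooth H) :
  (forall (E : algType K) (r : {linear E -> E ⊗[K] H}) (p : {lrmorphism E -> H}),
     rcomod_algebra r ->
     rcolinear r comul p ->
     (forall h, exists e, p e = h) ->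
     nilpotent_kernel p ->
     exists s : {lrmorphism H -> E}, rcolinear comul r s /\ cancel s p) /\
  (forall (E : algType K) (l : {linear E -> H ⊗[K] E}) (r : {linear E -> E ⊗[K] H})
          (p : {lrmorphism E -> H}),
     bicomod_algebra l r ->
     lcolinear l comul p /\ rcolinear r comul p ->
     (forall h, exists e, p e = h) ->
     nilpotent_kernel p ->
     exists s : {lrmorphism H -> E},
       [/\ lcolinear comul l s, rcolinear comul r s & cancel s p]).
Proof.
have [lambda lambdaP] := H_integral.
split=> [E r p [rP rM r1] pr p_surj nilp|].
  have sm := rcomodule_smoothing lambdaP rP rM r1 pr p_surj.
  (* The counit is the functional with value 1 at 1 that makes the initial section unital. *)
  have [s [sr sK]] := smoothing_section counit1 H_smooth p_surj nilp sm.
  by exists s.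
move=> E l r p [[lP rP lrP] [lM rM] [l1 r1]] [pl pr] p_surj nilp.
have smR := rcomodule_smoothing lambdaP rP rM r1 pr p_surj.
have smL := lcomodule_smoothing lambdaP lP lM l1 pl p_surj.
have sm := smoothing_comp smR smL (fun f => left_average_rcolinear lambda lrP).
have [s [[sl sr] sK]] := smoothing_section counit1 H_smooth p_surj nilp sm.
by exists s.
Qed.
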